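(* Let $n\ge2$ and let $\Phi$ be a smooth map satisfying Hörmander's condition for $\Phi$-Kakeya sets. Let $\varepsilon_\Phi>0$ be a sufficiently small constant depending on $\Phi$. Then there is a spray space $(M,\mathcal{U},\mathbf{G})$ and a map $$(W,\Xi):\mathcal{U}\to\mathbb{B}^{n-1}_{\varepsilon_\Phi}\times\mathbb{B}^{n-1}_{\varepsilon_\Phi},$$ whose restriction to $\mathcal{U}_x$ is written $(W_x,\Xi_x):\mathcal{U}_x\to\mathbb{B}^{n-1}_{\varepsilon_\Phi}\times\mathbb{B}^{n-1}_{\varepsilon_\Phi}$, with the following properties: the geodesic with tangent $v_x\in\mathcal{U}_x$ is the curve with parameters $(W_x(v_x),\Xi_x(v_x))$. Conversely, every curve with parameters in $\mathbb{B}^{n-1}_{\varepsilon_\Phi}\times\mathbb{B}^{n-1}_{\varepsilon_\Phi}$ is a geodesic of the spray space.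
   Context: $\mathbb{B}^m_r$ is the ball of radius $r$ about the origin in $\mathbb{R}^m$; everything is local near the origin. **Hörmander's condition.** $\Phi$ maps $(w,t;\xi)\in\mathbb{R}^{n-1}\times\mathbb{R}\times\mathbb{R}^{n-1}$ (near the origin) to $\mathbb{R}^n$; it satisfies Hörmander's condition at $(w,t;\xi)$ if the $n\times n$ matrix $\nabla_{(w,t)}\Phi$ and the $2n\times2n$ matrix $$\begin{bmatrix}0&\nabla_{(w,t)}\Phi&\nabla_\xi\Phi\\ \partial_t\Phi&\nabla_{(w,t)}\partial_t\Phi&\nabla_\xi\partial_t\Phi\end{bmatrix}$$ are non-degenerate at that point, and satisfies it on an open set if it does so at each of its points. The curve with parameters $(w,\xi)$ is $t\mapsto\Phi(w,t;\xi)$, $|t|\le\varepsilon_\Phi$; curves are identified up to parametrization as point sets. **Spray space.** A triple $(M,\mathcal{U},\mathbf{G})$ where $M$ is a manifold, $\mathcal{U}\subset TM\setminus0$ is open and fiberwise conic (each $\mathcal{U}_x:=\mathcal{U}\cap T_xM$ satisfies $\lambda\,\mathcal{U}_x=\mathcal{U}_x$ for all $\lambda>0$), and $\mathbf{G}$ is a vector field on $\mathcal{U}$ which in local coordinates $(x^i,y^i)$ has the form $\mathbf{G}=y^i\frac{\partial}{\partial x^i}-2G^i(x,y)\frac{\partial}{\partial y^i}$ with $G^i(x,\lambda y)=\lambda^2G^i(x,y)$ for every $\lambda>0$. Its geodesics are the projections to $M$ of integral curves of $\mathbf{G}$, i.e. solutions of $\ddot c^i+2G^i(c,\dot c)=0$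 with $(c,\dot c)\in\mathcal{U}$.
   Formalization: With curves taken over |t| ≤ ε the claim fails, since U is open (e.g. straight lines Φ = (w+tξ, t)); instead each maximal geodesic equals the curve over |t| < ε and its closure is the curve over |t| ≤ ε. Parameter balls are open. *)

(* Defs.v *)
From HB Require Import structures.
From mathcomp Require Import all_boot all_order all_algebra.
From mathcomp Require Import all_classical all_reals all_analysis.

Set Implicit Arguments.
Unset Strict Implicit.
Unset Printing Implicit Defensive.

Import Order.TTheory GRing.Theory Num.Theory.
Import numFieldNormedType.Exports.

Local Open Scope classical_set_scope.
Local Open Scope ring_scope.

(* The norm of 'rV[R]_m in the library is the sup norm, hence the need for a
   separate Euclidean ball (open). *)
Definition enorm (R : realType) (m : nat) (x : 'rV[R]_m) : R :=
  Num.sqrt (\sum_(i < m) x 0 i ^+ 2).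

Definition eball (R : realType) (m : nat) (r : R) : set 'rV[R]_m :=
  [set x | enorm x < r].

(* C^k on an open set D, through iterated directional derivatives. In finite
   dimension this is the usual notion, the directional derivatives being linear
   combinations of the partial ones. *)
Fixpoint Ck (R : realType) (V W : normedModType R) (k : nat)
    (D : set V) (f : V -> W) : Prop :=
  if k is k'.+1 then
    (forall p, D p -> differentiable f p) /\
    (forall v : V, Ck k' D (fun p => 'D_v f p))
  else forall p, D p -> {for p, continuous f}.

Definition smooth_on (R : realType) (V W : normedModType R)
    (D : set V) (f : V -> W) : Prop :=
  forall k, Ck k D f.

(* The two matrices of Hormander's condition have provably, but not
   convertibly, the same number of rows and columns; the cast makes the
   determinant well typed. *)
Definition nondegenerate (R : realType) (p q : nat) (A : 'M[R]_(p, q)) : Prop :=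
  exists e : q = p, \det (castmx (erefl p, e) A) != 0.

(* The space of (w, t, xi) in R^(n-1) x R x R^(n-1). *)
Definition param (R : realType) (n : nat) : normedModType R :=
  ('rV[R]_n.-1 * R * 'rV[R]_n.-1)%type.

Section Hormander.
Context {R : realType} {n : nat}.
Implicit Types (F Phi : param R n -> 'rV[R]_n) (p : param R n).

Definition dt F : param R n -> 'rV[R]_n :=
  fun p => 'D_((0, 1, 0) : param R n) F p.

(* Jacobian matrices: the i-th row belongs to the i-th component of F. *)
Definition grad_w F p : 'M[R]_(n, n.-1) :=
  \matrix_(i, j) ('D_((delta_mx 0 j, 0, 0) : param R n) F p) 0 i.

Definition grad_xi F p : 'M[R]_(n, n.-1) :=
  \matrix_(i, j) ('D_((0, 0, delta_mx 0 j) : param R n) F p) 0 i.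

Definition grad_wt F p : 'M[R]_(n, n.-1 + 1) :=
  row_mx (grad_w F p) (dt F p)^T.

Definition hormander_matrix Phi p : 'M[R]_(n + n, 1 + (n.-1 + 1 + n.-1)) :=
  block_mx 0             (row_mx (grad_wt Phi p)      (grad_xi Phi p))
           (dt Phi p)^T  (row_mx (grad_wt (dt Phi) p) (grad_xi (dt Phi) p)).

Definition hormander_at Phi p : Prop :=
  nondegenerate (grad_wt Phi p) /\ nondegenerate (hormander_matrix Phi p).

Definition hormander_on (D : set (param R n)) Phi : Prop :=
  forall p, D p -> hormander_at Phi p.

End Hormander.

(* A spray space whose manifold is an open subset M of R^n. Elements of
   TM = M x R^n are pairs (x, y), and the standard coordinates of R^n serve as
   the local coordinates. The vector field is y d/dx - 2 G(x, y) d/dy. *)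
Record spray_space (R : realType) (n : nat) := SpraySpace {
  spray_M : set 'rV[R]_n;
  spray_U : set ('rV[R]_n * 'rV[R]_n);
  spray_G : 'rV[R]_n * 'rV[R]_n -> 'rV[R]_n;
  spray_M_open : open spray_M;
  spray_U_open : open spray_U;
  spray_U_sub : forall x y, spray_U (x, y) -> spray_M x /\ y != 0;
  spray_U_conic : forall x (l : R), 0 < l ->
    [set l *: y | y in [set y | spray_U (x, y)]] = [set y | spray_U (x, y)];
  spray_G_smooth : smooth_on spray_U spray_G;
  spray_G_homogeneous : forall x y (l : R), spray_U (x, y) -> 0 < l ->
    spray_G (x, l *: y) = l ^+ 2 *: spray_G (x, y)
}.

Section Geodesics.
Context {R : realType} {n : nat} (S : spray_space R n).
Implicit Types (I J : set R) (g h : R -> 'rV[R]_n * 'rV[R]_n).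

Definition spray_field (v : 'rV[R]_n * 'rV[R]_n) : 'rV[R]_n * 'rV[R]_n :=
  (v.2, - (2 *: spray_G S v)).

Definition integral_curve I g : Prop :=
  [/\ open I, is_interval I, I !=set0 &
      forall s, I s -> spray_U S (g s) /\
                       is_derive s 1 g (spray_field (g s))].

Definition maximal_integral_curve I g : Prop :=
  integral_curve I g /\
  (forall J h, integral_curve J h -> I `<=` J ->
     (forall s, I s -> h s = g s) -> J `<=` I).

(* C is the point set in M of a maximal geodesic having v among its tangents. *)
Definition geodesic_with_tangent (v : 'rV[R]_n * 'rV[R]_n)
    (C : set 'rV[R]_n) : Prop :=
  exists I g, [/\ maximal_integral_curve I g,
                  exists2 s, I s & g s = v &
                  C = [set (g s).1 | s in I]].

Definition is_geodesic (C : set 'rV[R]_n) : Prop :=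
  exists2 v, spray_U S v & geodesic_with_tangent v C.

End Geodesics.

Definition curve (R : realType) (n : nat) (Phi : param R n -> 'rV[R]_n)
    (eps : R) (w xi : 'rV[R]_n.-1) : set 'rV[R]_n :=
  [set Phi (w, t, xi) | t in `[- eps, eps]].

Definition curve_interior (R : realType) (n : nat)
    (Phi : param R n -> 'rV[R]_n)
    (eps : R) (w xi : 'rV[R]_n.-1) : set 'rV[R]_n :=
  [set Phi (w, t, xi) | t in `]- eps, eps[].

(* A maximal integral curve in an open set lives on an open interval, whereas
   the curve carries its two end points t = eps and t = -eps. A geodesic is
   therefore compared with the curve without its end points, and the curve is
   recovered by adding to the geodesic its limit points. *)
Definition is_curve (R : realType) (n : nat) (Phi : param R n -> 'rV[R]_n)
    (eps : R) (w xi : 'rV[R]_n.-1) (C : set 'rV[R]_n) : Prop :=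
  C = curve_interior Phi eps w xi /\ closure C = curve Phi eps w xi.

(* Main.v *)
(** Let [F (w, t, xi, l) = (Phi, l * dt Phi)]. The second matrix of Hormander's
    condition is, up to rescaling one column and one block, the Jacobian of [F], so
    [F] is a local diffeomorphism where [l > 0], and rescaling tangents to a fixed
    norm makes it injective on (small box) x (l > 0). Its image [U] is open and
    conic, [F^-1] provides [W] and [Xi], and [G] is [- l^2 / 2 * dt (dt Phi)] read
    through [F^-1]. The spray field is the image under [dF] of the field [l d/dt],
    so [F^-1] straightens integral curves into affine lines along which only [t]
    varies; no uniqueness theorem for ODEs is needed. *)

Require Import Defs.
From HB Require Import structures.
From mathcomp Require Import all_boot all_order all_algebra.
From mathcomp Require Import all_classical all_reals all_analysis.
From mathcomp Require Import ring lra zify.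

Import Order.TTheory GRing.Theory Num.Theory.
Import numFieldNormedType.Exports.

Local Open Scope classical_set_scope.
Local Open Scope ring_scope.

Set Implicit Arguments.
Unset Strict Implicit.

(** * Smooth maps *)

(** The obstacle is that the fibres of [U] must be cones: the speed l is unbounded, whereas the
    inverse function theorem yields injectivity only near one point. Since [F] is linear in l, two
    points with the same image still have equal images once both tangents are brought to the norm of
    [dt Phi 0]; for small parameters this puts both speeds near 1, inside the neighbourhood of (0,
    1) where [F] is injective. The first matrix of Hörmander's condition gives [dt Phi <> 0], which
    allows this normalization, recovers l from the tangent, and keeps [U] away from the zero
    section. Openness of the image and smoothness of the inverse are local, so they hold at every
    speed at once.

    Straightening also settles maximality: an integral curve never leaves the image of the box, and
    only t moves, so a maximal one stops exactly when |t| reaches eps. Taking eps strictly below the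
    injectivity radius keeps the end points |t| = eps in the domain of smoothness of [Phi], so that
    the closure of the geodesic is the whole curve. *)

Lemma near_eq_differentiable (R : numFieldType) (V W : normedModType R)
    (f g : V -> W) (a : V) :
  {near a, f =1 g} -> differentiable f a -> differentiable g a.
Proof.
move=> fg df; have dfc := diff_continuous df.
have gE : g \o shift a = cst (g a) + 'd f a +o_ 0 id.
  apply/eqaddoP => e e0.
  have /eqaddoP/(_ _ e0) := diff_locally df; apply: filter_app.
  have : \forall h \near (0 : V), f (h + a) = g (h + a).
    by move: fg; rewrite (near_shift (0 : V) a) => fg0; apply: filterS fg0 => h /=; rewrite subr0.
  apply: filter_app; near=> h => /= fgh.
  by rewrite /shift/= !fctE/= fgh (nbhs_singleton fg).
apply/diff_locallyP; rewrite (diff_unique dfc gE); split=> //.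
Unshelve. all: by end_near. Qed.

Section Smooth.
Context {R : realType} {V W : normedModType R}.
Implicit Types (D : set V) (f g : V -> W).

Lemma Ck_eq_in k D f g : open D -> {in D, f =1 g} -> Ck k D f -> Ck k D g.
Proof.
move=> Do fg.
have nearfg h h' : {in D, h =1 h'} -> forall p, D p -> {near p, h =1 h' :> (V -> W)}.
  move=> hh' p Dp; have : \forall q \near p, D q by exact: open_nbhs_nbhs.
  by apply: filterS => q Dq; apply: hh'; rewrite inE.
elim: k f g fg => [|k IH] f g fg /=.
  move=> fc p Dp; rewrite /prop_for /continuous_at -fg ?inE//.
  by apply: cvg_trans (fc p Dp); apply: near_eq_cvg; exact: nearfg.
move=> [df dDf]; split=> [p Dp|v].
  by apply: near_eq_differentiable (df p Dp); exact: nearfg.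
apply: IH (dDf v) => p; rewrite inE => Dp.
by apply: near_eq_derive; exact: nearfg.
Qed.

(* Smoothness is a greatest fixed point: it suffices to exhibit a class of
   differentiable functions stable under directional derivatives on [D]. *)
Lemma smooth_coind D (P : (V -> W) -> Prop) : open D ->
  (forall f, P f -> (forall p, D p -> differentiable f p) /\
     forall v, exists2 g, P g & {in D, 'D_v f =1 g}) ->
  forall f, P f -> smooth_on D f.
Proof.
move=> Do PE f Pf k; elim: k f Pf => [|k IH] f Pf /=.
  by move=> p Dp; apply: differentiable_continuous; exact: (PE f Pf).1.
split; first exact: (PE f Pf).1.
move=> v; have [_ /(_ v)[g Pg gE]] := PE f Pf.
by apply: Ck_eq_in (IH g Pg) => // p pD; rewrite gE.
Qed.

Lemma smooth_on_differentiable D f p :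
  smooth_on D f -> D p -> differentiable f p.
Proof. by move=> /(_ 1%N) [df _]; exact: df. Qed.

Lemma smooth_on_derive D f v : smooth_on D f -> smooth_on D ('D_v f).
Proof. by move=> sf k; have [_ /(_ v)] := sf k.+1. Qed.

Lemma smooth_on_sub D D' f : D' `<=` D -> smooth_on D f -> smooth_on D' f.
Proof.
move=> DD' sf k; elim: k f sf => [|k IH] f sf /=.
  by move=> p /DD' Dp; apply/differentiable_continuous/(smooth_on_differentiable sf).
split=> [p /DD' Dp|v]; first exact: smooth_on_differentiable sf Dp.
exact/IH/smooth_on_derive.
Qed.

Lemma smooth_on_eq D f g : open D -> {in D, f =1 g} -> smooth_on D f -> smooth_on D g.
Proof. by move=> Do fg sf k; exact: Ck_eq_in (sf k). Qed.

Lemma smooth_on_cst D (c : W) : open D -> smooth_on D (cst c).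
Proof.
move=> Do; apply: (@smooth_coind D (fun f => exists c, f = cst c)) => //.
  move=> _ [d ->]; split=> [p _|v]; first exact: differentiable_cst.
  by exists (cst 0); [exists 0|move=> p _ /=; exact: derive_cst].
by exists c.
Qed.

End Smooth.

Section SmoothLinear.
Context {R : realType} {U V W : normedModType R}.

Lemma differentiable_linr (L : {linear V -> W}) (f : U -> V) p :
  continuous L -> differentiable f p ->
  differentiable (L \o f) p /\ forall v, 'D_v (L \o f) p = L ('D_v f p).
Proof.
move=> Lc df; have dL : differentiable L (f p) by exact: linear_differentiable.
have dc : differentiable (L \o f) p by exact: differentiable_comp.
split=> // v; rewrite !deriveE// diff_comp//= diff_lin//.
Qed.

Lemma differentiable_linl (L : {linear U -> V}) (f : V -> W) p :
  continuous L -> differentiable f (L p) ->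
  differentiable (f \o L) p /\ forall v, 'D_v (f \o L) p = 'D_(L v) f (L p).
Proof.
move=> Lc df; have dL : differentiable L p by exact: linear_differentiable.
have dc : differentiable (f \o L) p by exact: differentiable_comp.
split=> // v; rewrite !deriveE// diff_comp//= diff_lin//.
Qed.

Lemma smooth_on_linr (L : {linear V -> W}) (D : set U) (f : U -> V) : open D ->
  continuous L -> smooth_on D f -> smooth_on D (L \o f).
Proof.
move=> Do Lc sf; apply: (@smooth_coind _ _ _ D
  (fun h => exists2 g, smooth_on D g & h = L \o g)) => //; last by exists f.
move=> _ [g sg ->].
have dg p Dp := differentiable_linr Lc (@smooth_on_differentiable _ _ _ D g p sg Dp).
split=> [p /dg[]//|v]; exists (L \o 'D_v g) => [|p].
  by exists ('D_v g) => //; exact: smooth_on_derive.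
by rewrite inE => /dg[_ ->].
Qed.

Lemma smooth_on_linl (L : {linear U -> V}) (D : set V) (f : V -> W) : open D ->
  continuous L -> smooth_on D f -> smooth_on (L @^-1` D) (f \o L).
Proof.
move=> Do Lc sf; apply: (@smooth_coind _ _ _ _
  (fun h => exists2 g, smooth_on D g & h = g \o L)) => //; last by exists f.
  by apply: open_comp => // p _; exact: Lc.
move=> _ [g sg ->].
have dg p Dp := differentiable_linl Lc (@smooth_on_differentiable _ _ _ D g (L p) sg Dp).
split=> [p /dg[]//|v]; exists ('D_(L v) g \o L) => [|p].
  by exists ('D_(L v) g) => //; exact: smooth_on_derive.
by rewrite inE => /dg[_ ->].
Qed.

End SmoothLinear.

Section SmoothField.
Context {R : realType} {V : normedModType R} (D : set V) (Do : open D).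
Implicit Types f g : V -> R.

(** The coinduction principle needs a class stable under derivation. The derivative of f * g is a
    sum of products and that of 1/f is - f' / f^2, so sums, products and inverses have to be
    generated together. *)
Inductive rational_of_smooth : (V -> R) -> Prop :=
| rational_smooth f of smooth_on D f : rational_of_smooth f
| rational_add f g of rational_of_smooth f & rational_of_smooth g :
    rational_of_smooth (f + g)
| rational_mul f g of rational_of_smooth f & rational_of_smooth g :
    rational_of_smooth (f * g)
| rational_inv f of rational_of_smooth f & (forall p, D p -> f p != 0) :
    rational_of_smooth (fun p => (f p)^-1).

Lemma rational_of_smooth_smooth f : rational_of_smooth f -> smooth_on D f.
Proof.
apply: smooth_coind => // {}f.
elim=> [{}f sf|{}f g rf [df Df] rg [dg Dg]|{}f g rf [df Df] rg [dg Dg]|{}f rf [df Df] fN0].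
- split=> [p Dp|v]; first exact: smooth_on_differentiable sf Dp.
  by exists ('D_v f) => //; exact/rational_smooth/smooth_on_derive.
- split=> [p Dp|v]; first by apply: differentiableD; [exact: df|exact: dg].
  have [[f' rf' f'E] [g' rg' g'E]] := (Df v, Dg v).
  exists (f' + g'); first exact: rational_add.
  move=> p pD; have Dp : D p by rewrite inE in pD.
  rewrite deriveD ?f'E ?g'E//; apply: diff_derivable; [exact: df|exact: dg].
- split=> [p Dp|v]; first by apply: differentiableM; [exact: df|exact: dg].
  have [[f' rf' f'E] [g' rg' g'E]] := (Df v, Dg v).
  exists (f * g' + g * f').
    by apply: rational_add; apply: rational_mul.
  move=> p pD; have Dp : D p by rewrite inE in pD.
  rewrite deriveM ?f'E ?g'E//; apply: diff_derivable; [exact: df|exact: dg].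
- split=> [p Dp|v]; first by apply: differentiableV; [exact: df|exact: fN0].
  have [f' rf' f'E] := Df v.
  have rV := rational_inv rf fN0.
  exists (cst (-1) * ((fun p => (f p)^-1) * (fun p => (f p)^-1) * f')).
    apply: rational_mul; first exact/rational_smooth/smooth_on_cst.
    by do 2 apply: rational_mul => //.
  move=> p pD; have Dp : D p by rewrite inE in pD.
  rewrite deriveV ?f'E ?fN0//; last exact/diff_derivable/df.
  by rewrite !fctE /GRing.scale/= mulN1r mulNr expr2 invfM.
Qed.

Lemma smooth_on_add f g : smooth_on D f -> smooth_on D g -> smooth_on D (fun p => f p + g p).
Proof.
by move=> sf sg; apply: rational_of_smooth_smooth; apply: rational_add; exact: rational_smooth.
Qed.

Lemma smooth_on_mul f g : smooth_on D f -> smooth_on D g -> smooth_on D (fun p => f p * g p).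
Proof.
by move=> sf sg; apply: rational_of_smooth_smooth; apply: rational_mul; exact: rational_smooth.
Qed.

Lemma smooth_on_inv f : (forall p, D p -> f p != 0) ->
  smooth_on D f -> smooth_on D (fun p => (f p)^-1).
Proof.
by move=> f0 sf; apply: rational_of_smooth_smooth; apply: rational_inv => //; exact: rational_smooth.
Qed.

Lemma smooth_on_sum (I : Type) (r : seq I) (P : pred I) (F : I -> V -> R) :
  (forall i, smooth_on D (F i)) ->
  smooth_on D (fun p => \sum_(i <- r | P i) F i p).
Proof.
move=> sF; elim: r => [|i r IH].
  by apply: smooth_on_eq (smooth_on_cst (0 : R) Do) => // p _ /=; rewrite big_nil.
have [Pi|Pi] := boolP (P i); last first.
  by apply: smooth_on_eq IH => // p _; rewrite big_cons (negPf Pi).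
by apply: smooth_on_eq (smooth_on_add (sF i) IH) => // p _; rewrite big_cons Pi.
Qed.

Lemma smooth_on_prod (I : Type) (r : seq I) (P : pred I) (F : I -> V -> R) :
  (forall i, smooth_on D (F i)) ->
  smooth_on D (fun p => \prod_(i <- r | P i) F i p).
Proof.
move=> sF; elim: r => [|i r IH].
  by apply: smooth_on_eq (smooth_on_cst (1 : R) Do) => // p _ /=; rewrite big_nil.
have [Pi|Pi] := boolP (P i); last first.
  by apply: smooth_on_eq IH => // p _; rewrite big_cons (negPf Pi).
by apply: smooth_on_eq (smooth_on_mul (sF i) IH) => // p _; rewrite big_cons Pi.
Qed.

Lemma smooth_on_det n (A : V -> 'M[R]_n) :
  (forall i j, smooth_on D (fun p => A p i j)) -> smooth_on D (fun p => \det (A p)).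
Proof.
move=> sA; rewrite /determinant; apply: smooth_on_sum => s.
by apply: smooth_on_mul; [exact: smooth_on_cst|exact: smooth_on_prod].
Qed.

Lemma smooth_on_adj n (A : V -> 'M[R]_n) i j :
  (forall i j, smooth_on D (fun p => A p i j)) ->
  smooth_on D (fun p => \adj (A p) i j).
Proof.
move=> sA; apply: smooth_on_eq (_ : smooth_on D (fun p => cofactor (A p) j i)) => //.
  by move=> p _; rewrite mxE.
apply: smooth_on_mul; first exact: smooth_on_cst.
apply: smooth_on_det => k l.
by apply: smooth_on_eq (sA (lift j k) (lift i l)) => // p _; rewrite !mxE.
Qed.

(** Cramer's rule: the inverse is the adjugate over the determinant, hence rational in the
    entries. *)
Lemma smooth_on_invmx m n (A : V -> 'M[R]_(m, n)) :
  (forall i j, smooth_on D (fun p => A p i j)) ->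
  (forall p, D p -> Defs.nondegenerate (A p)) ->
  exists B : V -> 'M[R]_(n, m),
    (forall i j, smooth_on D (fun p => B p i j)) /\
    (forall p, D p -> A p *m B p = 1%:M /\ B p *m A p = 1%:M).
Proof.
move=> sA ndA.
(* The equality of the two dimensions is part of [nondegenerate] at a point, so it is available only
   if [D] is inhabited; on an empty [D] any [B] will do. *)
have [[p0 Dp0]|D0] := pselect (exists p, D p); last first.
  exists (fun=> 0); split=> [i j|p Dp]; last by case: D0; exists p.
  by apply: smooth_on_eq (smooth_on_cst (0 : R) Do) => // p _; rewrite mxE.
have [e _] := ndA p0 Dp0; case: m / e A sA ndA => A sA ndA.
have detA p : D p -> \det (A p) != 0.
  by move=> /ndA[e]; rewrite (eq_axiomK e).
exists (fun p => (\det (A p))^-1 *: \adj (A p)); split=> [i j|p Dp].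
  apply: smooth_on_eq (_ : smooth_on D (fun p => (\det (A p))^-1 * \adj (A p) i j)) => //.
    by move=> p _; rewrite [RHS]mxE.
  by apply: smooth_on_mul; [apply: smooth_on_inv => //; exact: smooth_on_det|exact: smooth_on_adj].
by rewrite -scalemxAr -scalemxAl mul_mx_adj mul_adj_mx scale_scalar_mx mulVf ?detA.
Qed.

End SmoothField.

Section SmoothMatrix.
Context {R : realType} {V : normedModType R} (D : set V) (Do : open D).

Lemma smooth_on_coord m n (f : V -> 'M[R]_(m, n)) i j :
  smooth_on D f -> smooth_on D (fun p => f p i j).
Proof.
have lin : linear (fun M : 'M[R]_(m, n) => M i j : R).
  by move=> k u v; rewrite !mxE.
pose cM := GRing.isLinear.Build _ _ _ _ _ lin.
pose c : {linear 'M[R]_(m, n) -> R} := HB.pack (fun M : 'M[R]_(m, n) => M i j : R) cM.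
by apply: (@smooth_on_linr _ _ _ _ c) => //; exact: coord_continuous.
Qed.

Lemma differentiable_matrix m n (f : V -> 'M[R]_(m, n)) p :
  (forall i j, differentiable (fun q => f q i j) p) -> differentiable f p.
Proof.
move=> df.
have -> : f = \sum_(i < m) \sum_(j < n) (fun q => f q i j *: delta_mx i j).
  apply/funext => q; rewrite [LHS]matrix_sum_delta fct_sumE.
  by apply: eq_bigr => i _; rewrite fct_sumE.
by do 2 (apply: differentiable_sum => ?); apply: differentiableZl.
Qed.

Lemma smooth_on_matrix m n (f : V -> 'M[R]_(m, n)) :
  (forall i j, smooth_on D (fun p => f p i j)) -> smooth_on D f.
Proof.
move: f; apply: (@smooth_coind _ _ _ _ (fun f : V -> 'M[R]_(m, n) =>
  forall i j, smooth_on D (fun p => f p i j))) => // f sf.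
have df p : D p -> differentiable f p.
  move=> Dp; apply: differentiable_matrix => i j.
  exact: smooth_on_differentiable (sf i j) Dp.
split=> // v; exists ('D_v f) => // i j.
apply: smooth_on_eq (smooth_on_derive v (sf i j)) => // p; rewrite inE => Dp.
by rewrite derive_mx ?mxE//; exact/diff_derivable/df.
Qed.

End SmoothMatrix.

(** * The inverse function theorem *)

Section MatrixNorm.
Context {R : realType}.

Lemma le_mx_norm m n (M : 'M[R]_(m, n)) i j : `|M i j| <= `|M|.
Proof.
by rewrite [leRHS]/Num.Def.normr/= mx_normrE; exact: (le_bigmax _ _ (i, j)).
Qed.

Lemma mx_norm_le m n (M : 'M[R]_(m, n)) c : 0 <= c ->
  (forall i j, `|M i j| <= c) -> `|M| <= c.
Proof.
move=> c0 Mc; rewrite [leLHS]/Num.Def.normr/= mx_normrE.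
by apply: bigmax_le => // -[i j] _; exact: Mc.
Qed.

Lemma norm_mulmx_le m n (v : 'rV[R]_m) (M : 'M[R]_(m, n)) :
  `|v *m M| <= m%:R * `|M| * `|v|.
Proof.
apply: mx_norm_le => [|i j]; first by rewrite !mulr_ge0.
rewrite mxE (le_trans (ler_norm_sum _ _ _))//.
rewrite -mulrA mulr_natl -[X in _ *+ X]card_ord -sumr_const.
apply: ler_sum => k _; rewrite normrM mulrC.
by apply: ler_pM => //; exact: le_mx_norm.
Qed.

Lemma mulmxr_continuous m n (M : 'M[R]_(m, n)) :
  continuous (mulmxr M : 'rV[R]_m -> 'rV[R]_n).
Proof.
apply: bounded_linear_continuous; apply/bounded_funP => r.
exists (m%:R * `|M| * r) => v vr; apply: le_trans (norm_mulmx_le _ _) _.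
by apply: ler_wpM2l vr; rewrite mulr_ge0.
Qed.

End MatrixNorm.

Section DeriveAlong.
Context {R : realType}.

Lemma is_derive_line (V W : normedModType R) (f : V -> W) y v (s : R) :
  differentiable f (s *: v + y) ->
  is_derive s (1 : R) (fun s => f (s *: v + y)) ('D_v f (s *: v + y)).
Proof.
move=> df.
have dl : is_diff s (( *:%R^~ v : R -> V) + cst y) ( *:%R^~ v).
  by apply: is_diff_eq; rewrite addr0.
have -> : (fun s => f (s *: v + y)) = f \o (( *:%R^~ v : R -> V) + cst y).
  exact/funext.
have dc : differentiable (f \o (( *:%R^~ v : R -> V) + cst y)) s.
  by apply: differentiable_comp; [exact: ex_diff|exact: df].
apply: DeriveDef; first exact: diff_derivable.
by rewrite deriveE// diff_comp// diff_val/= scale1r deriveE.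
Qed.

Lemma is_derive_coord (V : normedModType R) m n (f : V -> 'M[R]_(m, n)) p v df i j :
  is_derive p v f df -> is_derive p v (fun q => f q i j) (df i j).
Proof.
move=> [fpv <-]; apply: DeriveDef; first by have /derivable_mxP := fpv; exact.
by rewrite derive_mx// mxE.
Qed.

End DeriveAlong.

(** Makes row vectors a complete normed module, the setting of the Banach fixed point theorem in
    [image_open]. *)
HB.instance Definition _ (R : realType) m n := Complete.on 'M[R]_(m, n).

Section LocalInverse.
Context {R : realType} {m n : nat}.
Variables (D : set 'rV[R]_m) (f : 'rV[R]_m -> 'rV[R]_n).
Hypotheses (Do : open D) (sf : smooth_on D f).
(** The inverse Jacobian is a parameter and m, n are kept apart, because the two dimensions of the
    application, [1 + (n.-1 + 1 + n.-1)] and [n + n], are not convertible. Jacobians act on row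
    vectors from the right. *)
Variable B : 'rV[R]_m -> 'M[R]_(n, m).
Hypothesis jacB :
  forall u, D u -> jacobian f u *m B u = 1%:M /\ B u *m jacobian f u = 1%:M.

Lemma smooth_on_jacobian : smooth_on D (jacobian f).
Proof.
apply: smooth_on_matrix => // i j.
have sD : smooth_on D (fun u => 'D_(delta_mx 0 i) f u 0 j).
  by apply: smooth_on_coord => //; exact: smooth_on_derive.
apply: smooth_on_eq sD => // u; rewrite inE => Du.
have df := smooth_on_differentiable sf Du.
by rewrite deriveEjacobian// -rowE mxE.
Qed.

(** Mean value theorem on the segment from y to x, one coordinate at a time. The intermediate point
    depends on the coordinate, but the Jacobian is close to [jacobian f u0] at all of them, by
    continuity. *)
Lemma strictly_differentiable u0 e : D u0 -> 0 < e ->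
  exists2 d, 0 < d & ball u0 d `<=` D /\
    forall x y, ball u0 d x -> ball u0 d y ->
      `|f x - f y - (x - y) *m jacobian f u0| <= e * `|x - y|.
Proof.
move=> Du0 e0.
(* [norm_mulmx_le] costs a factor m; dividing by m + 1 also covers m = 0. *)
pose e' := e / (m%:R + 1).
have m1 : 0 < m%:R + 1 :> R by rewrite ltr_wpDl.
have e'0 : 0 < e' by rewrite divr_gt0.
have : \forall u \near u0, D u /\ `|jacobian f u0 - jacobian f u| < e'.
  near=> u; split; near: u; first exact: open_nbhs_nbhs.
  have /differentiable_continuous := smooth_on_differentiable smooth_on_jacobian Du0.
  by move/cvgrPdist_lt; exact.
move=> /nbhs_ballP[d d0 dD]; exists d => //; split=> [u /dD[]//|x y xd yd].
have inD (s : R) : 0 <= s -> s <= 1 -> ball u0 d (s *: (x - y) + y).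
  move=> s0 s1; move: xd yd; rewrite -ball_normE /ball_/= => xd yd.
  have -> : u0 - (s *: (x - y) + y) = s *: (u0 - x) + (1 - s) *: (u0 - y).
    rewrite !scalerBr !scalerBl !scale1r !opprD opprK !addrA.
    by apply/rowP => k; rewrite !mxE; ring.
  apply: (le_lt_trans (ler_normD _ _)); rewrite !normrZ !ger0_norm ?subr_ge0//.
  have M : Num.max `|u0 - x| `|u0 - y| < d by rewrite gt_max xd yd.
  apply: le_lt_trans M; rewrite -[leRHS]mul1r -[X in X * Num.max _ _](subrKC s) [leRHS]mulrDl.
  by apply: lerD; apply: ler_wpM2l; rewrite ?subr_ge0// le_max lexx ?orbT.
apply: mx_norm_le => [|i j]; first by rewrite mulr_ge0// ltW.
rewrite ord1 {i}.
pose h (s : R) : R := f (s *: (x - y) + y) 0 j.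
have dh (s : R) : 0 <= s -> s <= 1 ->
    is_derive s (1 : R) h (((x - y) *m jacobian f (s *: (x - y) + y)) 0 j).
  move=> s0 s1; have df : differentiable f (s *: (x - y) + y).
    by apply: smooth_on_differentiable sf _; have /dD[] := inD s s0 s1.
  by rewrite -deriveEjacobian//; apply: is_derive_coord; exact: is_derive_line.
have dh' (s : R) : s \in `]0, 1[%R ->
    is_derive s (1 : R) h (((x - y) *m jacobian f (s *: (x - y) + y)) 0 j).
  by rewrite in_itv/= => /andP[s0 s1]; apply: dh; exact: ltW.
have ch : {within `[0, 1], continuous h}.
  apply: derivable_within_continuous => s; rewrite in_itv/= => /andP[s0 s1].
  by have [] := dh s s0 s1.
have [s] := MVT ltr01 dh' ch.
rewrite in_itv/= => /andP[s0 s1]; rewrite /h scale1r subrK scale0r add0r subr0 mulr1 => fE.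
have -> : (f x - f y - (x - y) *m jacobian f u0) 0 j =
    ((x - y) *m (jacobian f (s *: (x - y) + y) - jacobian f u0)) 0 j.
  have mxB (M N : 'rV[R]_n) : (M - N) 0 j = M 0 j - N 0 j by rewrite !mxE.
  by rewrite mulmxBr !mxB fE.
set M := jacobian f _ - _.
apply: (le_trans (le_mx_norm ((x - y) *m M) 0 j)).
apply: (le_trans (norm_mulmx_le (x - y) M)).
apply: ler_wpM2r => //; rewrite {}/M.
have [_ Je] := dD _ (inD s (ltW s0) (ltW s1)).
have {}Je : `|jacobian f (s *: (x - y) + y) - jacobian f u0| <= e'.
  by rewrite -normrN opprB ltW.
apply: le_trans (_ : m%:R * e' <= _); first exact: ler_wpM2l.
by rewrite /e' mulrCA ler_piMr ?(ltW e0)// ler_pdivrMr// mul1r lerDl.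
Unshelve. all: by end_near. Qed.

(** Composing with [B u0] turns the linear part of f into the identity. This single estimate then
    yields injectivity, openness of the image and differentiability of the inverse. *)
Lemma near_isometry u0 e : D u0 -> 0 < e ->
  exists2 d, 0 < d & ball u0 d `<=` D /\
    forall x y, ball u0 d x -> ball u0 d y ->
      `|(f x - f y) *m B u0 - (x - y)| <= e * `|x - y|.
Proof.
move=> Du0 e0; pose K := n%:R * `|B u0| + 1.
have K0 : 0 < K by rewrite ltr_wpDl// mulr_ge0.
have [d d0 [dD df]] := strictly_differentiable Du0 (divr_gt0 e0 K0).
exists d => //; split=> // x y xd yd.
have -> : (f x - f y) *m B u0 - (x - y) =
    (f x - f y - (x - y) *m jacobian f u0) *m B u0.
  by rewrite [RHS]mulmxBl -[in RHS]mulmxA (jacB Du0).1 mulmx1.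
apply: le_trans (norm_mulmx_le _ _) _.
apply: le_trans (_ : K * (e / K * `|x - y|) <= _); last first.
  by rewrite mulrA mulrCA divff ?mulr1// gt_eqF.
apply: ler_pM => //; [by rewrite lerDl|exact: df].
Qed.

Let half_gt0 : 0 < 2^-1 :> R. Proof. by rewrite invr_gt0. Qed.

Lemma locally_injective u0 : D u0 -> exists2 d, 0 < d &
  ball u0 d `<=` D /\
  forall x y, ball u0 d x -> ball u0 d y -> f x = f y -> x = y.
Proof.
move=> Du0; have [d d0 [dD df]] := near_isometry Du0 half_gt0.
exists d => //; split=> // x y xd yd fxy.
have := df x y xd yd; rewrite fxy subrr mul0mx sub0r normrN => xy.
have : 0 <= `|x - y| by [].
by move=> xy0; apply/subr0_eq/normr0_eq0; lra.
Qed.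

Lemma image_open (O : set 'rV[R]_m) : open O -> O `<=` D -> open (f @` O).
Proof.
move=> Oo OD; rewrite openE => _ [u0 Ou0 <-]; have Du0 := OD _ Ou0.
have [d1 d10 [_ df]] := near_isometry Du0 half_gt0.
have /nbhs_ballP[d2 d20 d2O] : nbhs u0 O by exact: open_nbhs_nbhs.
(* Half of the minimum, so that the closed ball of radius r, on which the contraction acts, lies in
   both open balls. *)
pose r := Num.min d1 d2 / 2.
have r0 : 0 < r by rewrite divr_gt0// lt_min; apply/andP.
have rd : r < Num.min d1 d2 by rewrite /r gtr_pMr ?invf_lt1 ?ltr1n// lt_min; apply/andP.
have Ud1 x : `|u0 - x| <= r -> ball u0 d1 x.
  by rewrite -ball_normE /ball_/= => /le_lt_trans; apply; move: rd; rewrite lt_min => /andP[].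
have Ud2 x : `|u0 - x| <= r -> ball u0 d2 x.
  by rewrite -ball_normE /ball_/= => /le_lt_trans; apply; move: rd; rewrite lt_min => /andP[].
pose K := n%:R * `|B u0| + 1.
have K0 : 0 < K by rewrite ltr_wpDl// mulr_ge0.
(* K bounds the operator norm of [B u0], so a target y this close to [f u0] contributes at most r /
   2 to the displacement from u0; the contraction ratio 1/2 accounts for the other half. *)
apply/nbhs_ballP; exists (r / 2 / K); first by rewrite /= (divr_gt0 (divr_gt0 r0 _)).
move=> y; rewrite -ball_normE /ball_/= => yd.
pose U := [set x : 'rV[R]_m | `|u0 - x| <= r].
(* Newton's iteration with the derivative frozen at u0: its fixed points solve f x = y, as [B u0] is
   invertible. *)
pose T (x : 'rV[R]_m) := x - (f x - y) *m B u0.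
have TU : {homo T : x / U x >-> U x}.
  rewrite /U/= => x Ux.
  have -> : u0 - T x =
      ((f x - f u0) *m B u0 - (x - u0)) + (f u0 - y) *m B u0.
    rewrite /T opprB addrA addrC !addrA.
    rewrite [X in _ = _ + X]mulmxBl [X in _ = X - _ + _]mulmxBl mulmxBl.
    by apply/rowP => k; rewrite !mxE; ring.
  apply: le_trans (ler_normD _ _) _; rewrite (splitr r); apply: lerD.
    apply: le_trans (df x u0 (Ud1 _ Ux) (ballxx _ d10)) _.
    by rewrite mulrC distrC ler_pM2r.
  apply: le_trans (norm_mulmx_le _ _) _.
  apply: le_trans (_ : K * (r / 2 / K) <= _); last first.
    by rewrite mulrC divfK// gt_eqF.
  by apply: ler_pM => //; [rewrite lerDl|exact: ltW].
have ctrT : is_contraction (mkfun_fun TU).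
  have h1 : (2^-1 : R) < 1 by rewrite invf_lt1// ltr1n.
  exists (NngNum (ltW half_gt0)); split=> //= -[x x'] /= [Ux Ux'].
  have -> : mkfun TU x - mkfun TU x' = - ((f x - f x') *m B u0 - (x - x')).
    rewrite /mkfun /T !mulmxBl.
    by apply/rowP => k; rewrite !mxE; ring.
  by rewrite normrN; apply: df; exact: Ud1.
have Ucl : closed U by exact: closed_closed_ball_.
have [|x Ux xT] := banach_fixed_point ctrT Ucl; first by exists u0; rewrite /U/= subrr normr0 ltW.
exists x; first by apply: d2O; exact: Ud2.
have : (f x - y) *m B u0 = 0.
  by apply: oppr_inj; rewrite oppr0; apply: (addrI x); rewrite addr0.
move=> /(congr1 (mulmxr (jacobian f u0))); rewrite /= mul0mx -mulmxA (jacB Du0).2 mulmx1.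
exact: subr0_eq.
Qed.

Variables (O : set 'rV[R]_m) (g : 'rV[R]_n -> 'rV[R]_m).
Hypotheses (Oo : open O) (OD : O `<=` D) (gK : forall u, O u -> g (f u) = u).

(** By [image_open], every small increment h is f x - f u with x near u, so [near_isometry] bounds
    the linearization error of the inverse by c |x - u|. *)
Lemma inverse_differentiable u : O u ->
  differentiable g (f u) /\ 'd g (f u) = mulmxr (B u) :> ('rV[R]_n -> 'rV[R]_m).
Proof.
move=> Ou; have Du := OD Ou.
have Bc : continuous (mulmxr (B u) : 'rV[R]_n -> 'rV[R]_m) by exact: mulmxr_continuous.
suff gE : g \o shift (f u) = cst (g (f u)) + mulmxr (B u) +o_ 0 id.
  have dgE := diff_unique Bc gE.
  by split=> //; apply/diff_locallyP; rewrite dgE.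
apply/eqaddoP => e e0.
pose K := n%:R * `|B u| + 1.
have K0 : 0 < K by rewrite ltr_wpDl// mulr_ge0.
(* The bound 1/2 gives |x - u| <= 2 K |h|; the bound e / (2 K) then turns the error c |x - u| into
   at most e |h|. *)
pose c := Num.min 2^-1 (e / (2 * K)).
have c0 : 0 < c by rewrite lt_min half_gt0/= divr_gt0// mulr_gt0.
have [d d0 [dD df]] := near_isometry Du c0.
have : nbhs (f u) (f @` (O `&` ball u d)).
  apply: open_nbhs_nbhs; split.
    apply: image_open; first by apply: openI => //; exact: ball_open.
    by move=> x [/OD].
  by exists u => //; split=> //; exact: ballxx.
rewrite nbhs_nearE (near_shift (0 : 'rV[R]_n) (f u)) => near0.
apply: filterS near0 => h /=; rewrite subr0 => -[x [Ox xd] fxE].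
have hE : h = f x - f u by rewrite fxE addrK.
rewrite !fctE/= -fxE !gK// hE.
have -> : x - (u + (f x - f u) *m B u) = - ((f x - f u) *m B u - (x - u)).
  by rewrite !opprB opprD addrA.
rewrite normrN.
have xu := df x u xd (ballxx _ d0).
apply: (le_trans xu).
have cK : c * (2 * K) <= e by rewrite -ler_pdivlMr ?mulr_gt0// ge_min lexx orbT.
have c2 : c <= 2^-1 by rewrite ge_min lexx.
have KB : `|(f x - f u) *m B u| <= K * `|f x - f u|.
  by apply: le_trans (norm_mulmx_le _ _) _; apply: ler_wpM2r => //; rewrite lerDl.
have xu2 : `|x - u| <= 2 * K * `|f x - f u|.
  have tri : `|x - u| <= `|(f x - f u) *m B u| + `|(f x - f u) *m B u - (x - u)|.
    by rewrite -[X in `|X| <= _](subKr ((f x - f u) *m B u)) ler_normB.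
  have ch : c * `|x - u| <= 2^-1 * `|x - u| by exact: ler_wpM2r.
  by lra.
apply: le_trans (_ : c * (2 * K * `|f x - f u|) <= _); first exact: (ler_wpM2l (ltW c0) xu2).
by rewrite mulrA ler_wpM2r.
Qed.

(* The functions [b \o g] with [b] smooth form a class stable under derivatives,
   as [D_v (b \o g) = (fun u => D_(v *m B u) b u) \o g]. *)
Lemma inverse_smooth (a : 'rV[R]_m -> R) :
  (forall i j, smooth_on O (fun u => B u i j)) ->
  smooth_on O a -> smooth_on (f @` O) (a \o g).
Proof.
move=> sB sa; apply: (@smooth_coind _ _ _ _
  (fun h => exists2 b : 'rV[R]_m -> R, smooth_on O b & h = b \o g)); last by exists a.
  exact: image_open.
move=> _ [b sb ->].
have dbg u : O u -> differentiable (b \o g) (f u) /\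
    forall v, 'D_v (b \o g) (f u) = \sum_j (v *m B u) 0 j * 'D_(delta_mx 0 j) b u.
  move=> Ou; have [dg dgE] := inverse_differentiable Ou.
  have db : differentiable b (g (f u)) by rewrite gK//; exact: smooth_on_differentiable sb Ou.
  have dbg : differentiable (b \o g) (f u) by exact: differentiable_comp.
  split=> // v; rewrite deriveE// diff_comp//= dgE/= gK//.
  rewrite gK// in db.
  rewrite {1}[v *m B u]row_sum_delta linear_sum/=; apply: eq_bigr => j _.
  by rewrite linearZ/= deriveE.
split=> [_ [u Ou <-]|v]; first by have [] := dbg u Ou.
exists ((fun u => \sum_j (\sum_i v 0 i * B u i j) * 'D_(delta_mx 0 j) b u) \o g).
  exists (fun u => \sum_j (\sum_i v 0 i * B u i j) * 'D_(delta_mx 0 j) b u) => //.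
  apply: smooth_on_sum => // j; apply: smooth_on_mul => //; last exact: smooth_on_derive.
  apply: smooth_on_sum => // i; apply: smooth_on_mul => //; exact: smooth_on_cst.
move=> _ /set_mem[u Ou <-]; rewrite (dbg u Ou).2/= gK//.
by apply: eq_bigr => j _; rewrite mxE.
Qed.

End LocalInverse.

(** * Hormander's condition and the map [F] *)

Section Nondegenerate.
Context {R : realType} {p q : nat}.
Implicit Type A : 'M[R]_(p, q).

Lemma nondegenerate_kernel A : q = p ->
  (forall v : 'rV_p, v *m A = 0 -> v = 0) -> Defs.nondegenerate A.
Proof.
move=> e; case: p / e A => A kA; exists erefl; rewrite castmx_id.
suff : A \in unitmx by rewrite unitmxE unitfE.
rewrite -row_free_unit -kermx_eq0; apply/rowV0P => v /sub_kermxP; exact: kA.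
Qed.

Lemma nondegenerate_mulmx_eq0 A r (c : 'M[R]_(q, r)) :
  Defs.nondegenerate A -> A *m c = 0 -> c = 0.
Proof.
move=> [e]; case: p / e A => A; rewrite castmx_id => detA Ac.
have uA : A \in unitmx by rewrite unitmxE unitfE.
by rewrite -(mulKmx uA c) Ac mulmx0.
Qed.

End Nondegenerate.

Section Hormander.
Context {R : realType} {n : nat}.
Local Notation m := (1 + (n.-1 + 1 + n.-1))%N.
Implicit Types (u v : 'rV[R]_m) (p : param R n).

(* Row vectors serve as coordinates (l, w, t, xi), in the order of the columns of
   [hormander_matrix], [l] being the speed. *)
Definition chart_speed u : R := lsubmx u 0 0.
Definition chart_w u : 'rV[R]_n.-1 := lsubmx (lsubmx (rsubmx u)).
Definition chart_t u : R := rsubmx (lsubmx (rsubmx u)) 0 0.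
Definition chart_xi u : 'rV[R]_n.-1 := rsubmx (rsubmx u).
Definition chart_param u : param R n := (chart_w u, chart_t u, chart_xi u).

Definition chart_point p (l : R) : 'rV[R]_m :=
  row_mx l%:M (row_mx (row_mx p.1.1 p.1.2%:M) p.2).

Lemma chart_speedE p l : chart_speed (chart_point p l) = l.
Proof. by rewrite /chart_speed /chart_point row_mxKl mxE eqxx. Qed.

Lemma chart_paramE p l : chart_param (chart_point p l) = p.
Proof.
case: p => -[w t] xi; rewrite /chart_param /chart_w /chart_t /chart_xi /chart_point.
by rewrite !(row_mxKr, row_mxKl) mxE eqxx.
Qed.

Lemma chart_pointK u : chart_point (chart_param u) (chart_speed u) = u.
Proof.
have sc (M : 'M[R]_1) : (M 0 0)%:M = M by rewrite -mx11_scalar.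
by rewrite /chart_point /chart_param /= !sc !hsubmxK.
Qed.

Lemma chart_speed_linear : linear chart_speed.
Proof. by move=> k u v; rewrite /chart_speed linearP/= !mxE. Qed.
HB.instance Definition _ :=
  GRing.isLinear.Build R 'rV[R]_m R _ chart_speed chart_speed_linear.

Lemma chart_param_linear : linear chart_param.
Proof.
move=> k u v; rewrite /chart_param /chart_w /chart_t /chart_xi !linearP/=.
by congr (_, _, _); rewrite !mxE.
Qed.
HB.instance Definition _ :=
  GRing.isLinear.Build R 'rV[R]_m (param R n) _ chart_param chart_param_linear.

Lemma chart_speed_continuous : continuous chart_speed.
Proof.
move=> u; apply: (@continuous_comp _ _ _ lsubmx (fun M : 'M[R]_1 => M 0 0)).
  exact: continuous_lsubmx.
exact: coord_continuous.
Qed.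

Lemma chart_w_continuous : continuous chart_w.
Proof.
by move=> u; do 2 (apply: continuous_comp; [|exact: continuous_lsubmx]);
  exact: continuous_rsubmx.
Qed.

Lemma chart_xi_continuous : continuous chart_xi.
Proof. by move=> u; apply: continuous_comp; exact: continuous_rsubmx. Qed.

Lemma chart_t_continuous : continuous chart_t.
Proof.
move=> u; apply: (@continuous_comp _ _ _ (rsubmx \o (lsubmx \o rsubmx)) (fun M : 'M[R]_1 => M 0 0)).
  apply: continuous_comp; [apply: continuous_comp; [|exact: continuous_lsubmx]|];
    exact: continuous_rsubmx.
exact: coord_continuous.
Qed.

Lemma chart_param_continuous : continuous chart_param.
Proof.
move=> u.
exact: (cvg_pair (cvg_pair (@chart_w_continuous u) (@chart_t_continuous u)) (@chart_xi_continuous u)).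
Qed.

Lemma param_sum_delta (q : param R n) : q =
  (\sum_j q.1.1 0 j *: ((delta_mx 0 j, 0, 0) : param R n)) +
  q.1.2 *: ((0, 1, 0) : param R n) +
  \sum_j q.2 0 j *: ((0, 0, delta_mx 0 j) : param R n).
Proof.
case: q => -[w t] xi /=.
have lw : linear (fun w : 'rV[R]_n.-1 => (w, 0, 0) : param R n).
  by move=> k u v; congr (_, _, _); rewrite /= ?scaler0 ?addr0.
have lxi : linear (fun w : 'rV[R]_n.-1 => (0, 0, w) : param R n).
  by move=> k u v; congr (_, _, _); rewrite /= ?scaler0 ?addr0.
pose iw : {linear _ -> _} := HB.pack (fun w : 'rV[R]_n.-1 => (w, 0, 0) : param R n)
  (GRing.isLinear.Build _ _ _ _ _ lw).
pose ixi : {linear _ -> _} := HB.pack (fun w : 'rV[R]_n.-1 => (0, 0, w) : param R n)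
  (GRing.isLinear.Build _ _ _ _ _ lxi).
have -> : \sum_j w 0 j *: ((delta_mx 0 j, 0, 0) : param R n) = (w, 0, 0).
  rewrite -[RHS]/(iw w) [in RHS](row_sum_delta w) linear_sum.
  by apply: eq_bigr => j _; rewrite linearZ.
have -> : \sum_j xi 0 j *: ((0, 0, delta_mx 0 j) : param R n) = (0, 0, xi).
  rewrite -[RHS]/(ixi xi) [in RHS](row_sum_delta xi) linear_sum.
  by apply: eq_bigr => j _; rewrite linearZ.
by congr (_, _, _); rewrite /= ?scaler0 ?addr0 ?add0r// /GRing.scale/= mulr1.
Qed.

(** Translates the block rows of [hormander_matrix] into directional derivatives. *)
Lemma grad_mulmx (F : param R n -> 'rV[R]_n) p q : differentiable F p ->
  grad_wt F p *m col_mx q.1.1^T q.1.2%:M + grad_xi F p *m q.2^T = ('D_q F p)^T.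
Proof.
move=> dF; rewrite /grad_wt mul_row_col [in RHS](param_sum_delta q).
rewrite deriveE// !linearD/= !linear_sum/= linearZ/=.
rewrite mul_mx_scalar /dt deriveE//.
congr (_ + _ + _).
- apply/colP => i; rewrite !mxE summxE; apply: eq_bigr => j _.
  by rewrite linearZ/= !mxE deriveE// mulrC.
- by rewrite linearZ.
- apply/colP => i; rewrite !mxE summxE; apply: eq_bigr => j _.
  by rewrite linearZ/= !mxE deriveE// mulrC.
Qed.

End Hormander.

Lemma smooth_on_linear (R : realType) (V W : normedModType R) (D : set V)
  (L : {linear V -> W}) : open D -> continuous L -> smooth_on D L.
Proof.
move=> Do Lc; apply: (@smooth_coind _ _ _ D
  (fun f : V -> W => f = L \/ exists c, f = cst c)) => //; last by left.
move=> _ [->|[c ->]]; split=> [p _|v].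
- exact: linear_differentiable.
- exists (cst (L v)); first by right; exists (L v).
  by move=> p _ /=; rewrite deriveE ?diff_lin//; exact: linear_differentiable.
- exact: differentiable_cst.
- by exists (cst 0); [right; exists 0|move=> p _ /=; exact: derive_cst].
Qed.

Lemma derive_scale (R : realType) (V : normedModType R) m n
    (a : V -> R) (h : V -> 'M[R]_(m, n)) p v :
  derivable a p v -> derivable h p v ->
  'D_v (fun x => a x *: h x) p = 'D_v a p *: h p + a p *: 'D_v h p.
Proof.
move=> da dh.
have dhij i j : derivable (fun x => h x i j) p v by have /derivable_mxP := dh; exact.
have E i j : (fun x => (a x *: h x) i j) = a * (fun x => h x i j).
  by apply/funext => x; rewrite mxE.
rewrite derive_mx; last first.
  by apply/derivable_mxP => i j; rewrite E; exact: derivableM.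
apply/matrixP => i j; rewrite [LHS]mxE E.
have S (M N : 'M[R]_(m, n)) c d : (c *: M + d *: N) i j = c * M i j + d * N i j.
  by rewrite !mxE.
have -> : 'D_v h p = \matrix_(i, j) 'D_v (fun x => h x i j) p := derive_mx dh.
by rewrite S deriveM// [in RHS]mxE addrC [X in X + _]mulrC.
Qed.

Section SprayMap.
Context {R : realType} {n : nat}.
Local Notation m := (1 + (n.-1 + 1 + n.-1))%N.
Variables (Phi : param R n -> 'rV[R]_n) (Omega : set (param R n)).
Hypotheses (n_gt0 : (0 < n)%N) (Omega_open : open Omega).
Hypotheses (Phi_smooth : smooth_on Omega Phi).
Hypotheses (Phi_hormander : hormander_on Omega Phi).

(** The map [F] of the overview, its two components concatenated into one row so that [jacobian]
    applies. *)
Definition spray_map (u : 'rV[R]_m) : 'rV[R]_(n + n) :=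
  row_mx (Phi (chart_param u)) (chart_speed u *: dt Phi (chart_param u)).

Definition spray_dom : set 'rV[R]_m :=
  [set u | Omega (chart_param u) /\ 0 < chart_speed u].

Lemma spray_dom_open : open spray_dom.
Proof.
apply: openI.
  by apply: open_comp Omega_open => u _; exact: chart_param_continuous.
apply: (@open_comp _ _ chart_speed [set x | 0 < x]) => [u _|]; last exact: open_gt.
exact: chart_speed_continuous.
Qed.

Lemma smooth_on_chart_param (W : normedModType R) (f : param R n -> W) :
  smooth_on Omega f -> smooth_on spray_dom (f \o chart_param).
Proof.
move=> sf; apply: (smooth_on_sub (D := chart_param @^-1` Omega)); first by move=> u [].
by apply: smooth_on_linl => //; exact: chart_param_continuous.
Qed.

Lemma chart_speed_smooth : smooth_on spray_dom chart_speed.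
Proof. exact: (smooth_on_linear spray_dom_open (@chart_speed_continuous R n)). Qed.

Lemma spray_map_smooth : smooth_on spray_dom spray_map.
Proof.
have Do := spray_dom_open.
apply: smooth_on_matrix => // i j; rewrite -(fintype.splitK j); case: (fintype.split j) => k /=.
  apply: smooth_on_eq (_ : smooth_on _ (fun u => Phi (chart_param u) i k)) => //.
    by move=> u _; rewrite /spray_map row_mxEl.
  exact/smooth_on_coord/smooth_on_chart_param.
apply: smooth_on_eq (_ : smooth_on _ (fun u => chart_speed u * dt Phi (chart_param u) i k)) => //.
  by move=> u _; rewrite /spray_map row_mxEr mxE.
apply: smooth_on_mul => //; first exact: chart_speed_smooth.
exact/smooth_on_coord/smooth_on_chart_param/smooth_on_derive.
Qed.

Lemma derive_spray_map u v : spray_dom u -> 'D_v spray_map u =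
  row_mx ('D_(chart_param v) Phi (chart_param u))
    (chart_speed v *: dt Phi (chart_param u) +
     chart_speed u *: 'D_(chart_param v) (dt Phi) (chart_param u)).
Proof.
move=> Du; have [Ou _] := Du.
have dF := smooth_on_differentiable spray_map_smooth Du.
have dP := smooth_on_differentiable Phi_smooth Ou.
have sdt : smooth_on Omega (dt Phi) by exact: smooth_on_derive.
have ddt := smooth_on_differentiable sdt Ou.
have [dPc DPc] := differentiable_linl (@chart_param_continuous R n) dP.
have [ddtc Ddtc] := differentiable_linl (@chart_param_continuous R n) ddt.
have dsp : differentiable chart_speed u := smooth_on_differentiable chart_speed_smooth Du.
rewrite -[LHS]hsubmxK; congr row_mx.
  rewrite -(differentiable_linr (@continuous_lsubmx R 1 n n) dF).2 -DPc.
  rewrite (_ : lsubmx \o spray_map = Phi \o chart_param)//.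
  by apply/funext => x /=; rewrite /spray_map row_mxKl.
rewrite -(differentiable_linr (@continuous_rsubmx R 1 n n) dF).2.
have -> : rsubmx \o spray_map = fun x => chart_speed x *: (dt Phi \o chart_param) x.
  by apply/funext => x /=; rewrite /spray_map row_mxKr.
rewrite derive_scale; [|exact: diff_derivable|exact: diff_derivable].
by rewrite Ddtc (deriveE _ dsp) (diff_lin _ (@chart_speed_continuous R n)).
Qed.

Lemma jacobian_spray_map_nondegenerate u :
  spray_dom u -> Defs.nondegenerate (jacobian spray_map u).
Proof.
move=> Du; have [Ou lu] := Du.
(* The two dimensions agree only because n > 0, the predecessor of 0 being 0. *)
apply: nondegenerate_kernel; first by case: n n_gt0 => // k _; lia.
move=> v; rewrite -deriveEjacobian; last exact: smooth_on_differentiable spray_map_smooth Du.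
rewrite derive_spray_map// -[0]row_mx0 => /eq_row_mx[DP Ddt].
have dP := smooth_on_differentiable Phi_smooth Ou.
have sdt : smooth_on Omega (dt Phi) by exact: smooth_on_derive.
have ddt := smooth_on_differentiable sdt Ou.
have [_ Hnd] := Phi_hormander Ou.
set q := chart_param v in DP Ddt.
(* After division by the speed of u, the equation [Ddt] is the lower block row of [hormander_matrix]
   applied to (a, q), and [DP] is the upper one. *)
pose a := chart_speed v / chart_speed u.
have : hormander_matrix Phi (chart_param u) *m
    col_mx a%:M (col_mx (col_mx q.1.1^T q.1.2%:M) q.2^T) = 0.
  rewrite /hormander_matrix mul_block_col mul0mx add0r.
  rewrite (mul_row_col (grad_wt Phi _)) (mul_row_col (grad_wt (dt Phi) _)).
  rewrite (grad_mulmx q dP) (grad_mulmx q ddt) DP trmx0 mul_mx_scalar.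
  rewrite -[RHS]col_mx0; congr col_mx.
  apply: trmx_inj; rewrite trmx0 linearD/= linearZ/= !trmxK.
  apply: (@scalerI _ _ (chart_speed u)); first by rewrite gt_eqF.
  by rewrite scaler0 scalerDr scalerA /a mulrC divfK ?gt_eqF.
move=> /(nondegenerate_mulmx_eq0 Hnd).
rewrite -[0]col_mx0 => /eq_col_mx[a0].
rewrite -[0]col_mx0 => /eq_col_mx[].
rewrite -[0]col_mx0 => /eq_col_mx[w0 t0 xi0].
have lv0 : chart_speed v = 0.
  have /eqP : a = 0 by move/matrixP/(_ 0 0): a0; rewrite !mxE.
  by rewrite mulf_eq0 invr_eq0 (gt_eqF lu) orbF => /eqP.
have q0 : q = 0.
  case: (q) w0 t0 xi0 => -[w t] xi /= w0 t0 xi0; congr (_, _, _).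
  - by apply: trmx_inj; rewrite w0 trmx0.
  - by move/matrixP/(_ 0 0): t0; rewrite !mxE.
  - by apply: trmx_inj; rewrite xi0 trmx0.
rewrite -(chart_pointK v) -/q q0 lv0 /chart_point/=.
by rewrite raddf0 !row_mx0.
Qed.

End SprayMap.

(** * Injectivity on a small box, for all speeds *)

Lemma near0_norm (R : realType) (V : normedModType R) (P : set V) :
  (\forall p \near (0 : V), P p) ->
  exists2 r : R, 0 < r & forall p, `|p| < r -> P p.
Proof.
move=> /nbhs_ballP[r r0 rP]; exists r => // p pr.
by apply: rP; rewrite -ball_normE /ball_/= sub0r normrN.
Qed.

(** Normalizing to norm c forgets positive factors, so unknown speeds can be traded for known
    ones. *)
Lemma normalized_eq (R : realType) (V : normedModType R) (q q' : V) (l l' c : R) :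
  0 < l -> 0 < l' -> l *: q = l' *: q' -> (c / `|q|) *: q = (c / `|q'|) *: q'.
Proof.
have scE (x : V) (k : R) : 0 < k -> (c / `|x|) *: x = (c / `|k *: x|) *: (k *: x).
  move=> k0; have [->|x0] := eqVneq x 0; first by rewrite !scaler0.
  rewrite normrZ gtr0_norm// scalerA; congr (_ *: _).
  by field; rewrite normr_eq0 x0 gt_eqF.
by move=> l0 l'0 lqq'; rewrite (scE q l)// (scE q' l')// lqq'.
Qed.

Section Injectivity.
Context {R : realType} {n : nat}.
Local Notation m := (1 + (n.-1 + 1 + n.-1))%N.
Variables (Phi : param R n -> 'rV[R]_n) (Omega : set (param R n)).
Hypotheses (n_gt0 : (0 < n)%N) (Omega_open : open Omega) (Omega_origin : Omega 0).
Hypotheses (Phi_smooth : smooth_on Omega Phi).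
Hypotheses (Phi_hormander : hormander_on Omega Phi).

(** [dt Phi p] is the last column of the first matrix of Hörmander's condition, and a nondegenerate
    matrix has no zero column. *)
Lemma hormander_dt_neq0 p : Omega p -> dt Phi p != 0.
Proof.
move=> /Phi_hormander[gnd _]; apply/eqP => dt0.
have : grad_wt Phi p *m col_mx 0 (1%:M : 'M[R]_1) = 0.
  by rewrite /grad_wt (mul_row_col (grad_w Phi p)) mulmx0 add0r mulmx1 dt0 trmx0.
move=> /(nondegenerate_mulmx_eq0 gnd); move=> /(congr1 dsubmx).
rewrite col_mxKd linear0.
by move=> /matrixP/(_ 0 0)/eqP; rewrite !mxE/= oner_eq0.
Qed.

Lemma spray_map_point (p : param R n) l :
  spray_map Phi (chart_point p l) = row_mx (Phi p) (l *: dt Phi p).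
Proof. by rewrite /spray_map (chart_paramE p l) (chart_speedE p l). Qed.

Lemma chart_point_norm_le (p : param R n) l :
  `|chart_point p l| <= Num.max `|l| `|p|.
Proof.
have nw : `|p.1.1| <= `|p| by rewrite !prod_normE !le_max lexx.
have nt : `|p.1.2| <= `|p| by rewrite !prod_normE !le_max lexx orbT.
have nxi : `|p.2| <= `|p| by rewrite !prod_normE !le_max lexx orbT.
have np : `|p| <= Num.max `|l| `|p| by rewrite le_max lexx orbT.
apply: mx_norm_le => [|i j]; first by rewrite le_max normr_ge0.
rewrite /chart_point !mxE; case: (fintype.split j) => {}j.
  by rewrite !mxE ord1 (ord1 j) eqxx le_max lexx.
apply: (le_trans _ np).
rewrite !mxE; case: (fintype.split j) => {}j.
  rewrite !mxE; case: (fintype.split j) => {}j.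
    by apply: le_trans nw; exact: le_mx_norm.
  by rewrite !mxE ord1 (ord1 j) eqxx.
by apply: le_trans nxi; exact: le_mx_norm.
Qed.

Lemma chart_pointB (p p' : param R n) l l' :
  chart_point p l - chart_point p' l' = chart_point (p - p') (l - l').
Proof.
case: p p' => -[w t] xi [[w' t'] xi']; rewrite /chart_point /=.
by rewrite !opp_row_mx !add_row_mx -!raddfB.
Qed.

Lemma spray_map_locally_injective : exists2 d : R, 0 < d &
  forall p p' l l', `|p| < d -> `|p'| < d -> `|1 - l| < d -> `|1 - l'| < d ->
    Phi p = Phi p' -> l *: dt Phi p = l' *: dt Phi p' -> p = p'.
Proof.
have [B [_ jacB]] := smooth_on_invmx (spray_dom_open Omega_open)
  (fun i j => smooth_on_coord (spray_dom_open Omega_open) i j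
    (smooth_on_jacobian (spray_dom_open Omega_open)
      (spray_map_smooth Omega_open Phi_smooth)))
  (jacobian_spray_map_nondegenerate n_gt0 Omega_open Phi_smooth Phi_hormander).
(* The base point is the parameter 0 at speed 1; any fixed positive speed would serve as the
   normalization. *)
have Du0 : spray_dom Omega (chart_point 0 1).
  by split; rewrite ?chart_paramE ?chart_speedE.
have [d d0 [_ Finj]] := locally_injective (spray_dom_open Omega_open)
  (spray_map_smooth Omega_open Phi_smooth) jacB Du0.
clear jacB Du0.
exists d; first exact: d0.
have inb (p : param R n) l :
    `|p| < d -> `|1 - l| < d -> ball (chart_point 0 1) d (chart_point p l).
  move=> pd kpd; rewrite -ball_normE /ball_/= chart_pointB.
  by apply: le_lt_trans (chart_point_norm_le _ _) _; rewrite gt_max kpd sub0r normrN.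
move=> p p' l l' pd p'd ld l'd Peq dteq.
rewrite -(chart_paramE p l) -(chart_paramE p' l'); congr chart_param.
apply: Finj; [exact: inb|exact: inb|].
apply: (etrans (spray_map_point _ _)).
apply: (etrans _ (esym (spray_map_point _ _))).
by rewrite Peq dteq.
Qed.

(** The radius r constrains the parameters only and leaves the speeds free, as a conic [U]
    requires. *)
Lemma spray_map_injective : exists2 r : R, 0 < r &
  (forall p, `|p| < r -> Omega p) /\
  forall u u' : 'rV[R]_m, `|chart_param u| < r -> `|chart_param u'| < r ->
    0 < chart_speed u -> 0 < chart_speed u' ->
    spray_map Phi u = spray_map Phi u' -> u = u'.
Proof.
have [d d0 Finj] := spray_map_locally_injective.
have c0 : 0 < `|dt Phi 0| by rewrite normr_gt0; exact: hormander_dt_neq0.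
(* Rescaling the tangent to a fixed norm brings the speed close to 1, where
   the local injectivity applies. *)
pose k p := `|dt Phi 0| / `|dt Phi p|.
have kc : k p @[p --> (0 : param R n)] --> (1 : R).
  rewrite -(divff (lt0r_neq0 c0)); apply: cvgM; first exact: cvg_cst.
  apply: cvgV; first exact: lt0r_neq0.
  apply: cvg_norm; apply: differentiable_continuous.
  by apply: smooth_on_differentiable Omega_origin; exact: smooth_on_derive.
have : \forall p \near (0 : param R n), [/\ Omega p, `|p| < d & `|1 - k p| < d].
  near=> p; split; near: p.
  - exact: open_nbhs_nbhs.
  - by apply: cvgr0_norm_lt => //; exact: cvg_id.
  - by move/cvgrPdist_lt: kc; exact.
clear kc.
move=> /near0_norm[r r0 rP]; exists r; first exact: r0.
have inj p p' l l' : `|p| < r -> `|p'| < r -> 0 < l -> 0 < l' ->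
    Phi p = Phi p' -> l *: dt Phi p = l' *: dt Phi p' -> p = p' /\ l = l'.
  move=> /rP[Op pd kpd] /rP[Op' p'd kp'd] l0 l'0 Peq dteq.
  have peq : p = p'.
    apply: (Finj p p' (k p) (k p') pd p'd kpd kp'd Peq).
    exact: normalized_eq l0 l'0 dteq.
  split; first exact: peq.
  (* With the parameters equal, the tangents are multiples of one nonzero vector, so the speeds
     agree. *)
  have q0 := hormander_dt_neq0 Op.
  move: dteq; rewrite -peq => /eqP; rewrite -subr_eq0 -scalerBl scaler_eq0.
  by rewrite (negPf q0) orbF subr_eq0 => /eqP.
split=> [p /rP[]//|u u' ur u'r lu lu'].
rewrite /spray_map => /eq_row_mx[Peq dteq].
have [peq leq] := inj _ _ _ _ ur u'r lu lu' Peq dteq.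
by rewrite -(chart_pointK u) peq leq chart_pointK.
Unshelve. all: by end_near. Qed.

End Injectivity.

(** * The spray *)

Section EuclideanBall.
Context {R : realType} {k : nat}.

(** The radius r is measured in the sup norm of the parameter space, while the parameter balls of
    the theorem are Euclidean. *)
Lemma norm_le_enorm (x : 'rV[R]_k) : `|x| <= enorm x.
Proof.
apply: mx_norm_le => [|i j]; first exact: sqrtr_ge0.
rewrite ord1 -sqrtr_sqr; apply: ler_wsqrtr.
by rewrite (bigD1 j)//= lerDl sumr_ge0// => l _; exact: sqr_ge0.
Qed.

Lemma enorm_continuous : continuous (@enorm R k).
Proof.
move=> x; apply: continuous_comp; last exact: sqrt_continuous.
apply: cvg_big; [exact: add_continuous|exact: nbhs_filter|move=> i _].
apply: (@continuous_comp _ _ _ (fun M : 'rV[R]_k => M 0 i) (fun z => z ^+ 2)).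
  exact: coord_continuous.
exact: exprn_continuous.
Qed.

Lemma eball_open (r : R) : open (@eball R k r).
Proof.
apply: (@open_comp _ _ (@enorm R k) [set y | y < r]); last exact: open_lt.
by move=> x _; exact: enorm_continuous.
Qed.

End EuclideanBall.

Section PairRow.
Context {R : realType} {n : nat}.

(** Tangent vectors are pairs in [spray_space], but the inverse function theorem above is about row
    vectors; these maps pass between the two. *)
Definition row_of_pair (v : 'rV[R]_n * 'rV[R]_n) : 'rV[R]_(n + n) :=
  row_mx v.1 v.2.

Definition pair_of_row (y : 'rV[R]_(n + n)) : 'rV[R]_n * 'rV[R]_n :=
  (lsubmx y, rsubmx y).

Lemma row_of_pairK : cancel row_of_pair pair_of_row.
Proof. by case=> x y; rewrite /pair_of_row row_mxKl row_mxKr. Qed.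

Lemma pair_of_rowK : cancel pair_of_row row_of_pair.
Proof. by move=> y; exact: hsubmxK. Qed.

Lemma row_of_pair_linear : linear row_of_pair.
Proof.
by move=> k [x y] [x' y']; rewrite /row_of_pair/= -add_row_mx -scale_row_mx.
Qed.
HB.instance Definition _ := GRing.isLinear.Build R
  ('rV[R]_n * 'rV[R]_n)%type 'rV[R]_(n + n) _ row_of_pair row_of_pair_linear.

Lemma pair_of_row_linear : linear pair_of_row.
Proof. by move=> k x y; rewrite /pair_of_row !linearP. Qed.
HB.instance Definition _ := GRing.isLinear.Build R
  'rV[R]_(n + n) ('rV[R]_n * 'rV[R]_n)%type _ pair_of_row pair_of_row_linear.

Lemma row_of_pair_continuous : continuous row_of_pair.
Proof.
apply: bounded_linear_continuous; apply/bounded_funP => r.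
exists r => v; apply: le_trans; apply: mx_norm_le => // i j.
rewrite mxE prod_normE le_max; case: (fintype.split j) => k.
  by rewrite le_mx_norm.
by rewrite le_mx_norm orbT.
Qed.

Lemma pair_of_row_continuous : continuous pair_of_row.
Proof.
move=> y.
exact: (cvg_pair (@continuous_lsubmx R 1 n n y) (@continuous_rsubmx R 1 n n y)).
Qed.

End PairRow.

Section Spray.
Context {R : realType} {n : nat}.
Local Notation m := (1 + (n.-1 + 1 + n.-1))%N.
Variables (Phi : param R n -> 'rV[R]_n) (Omega : set (param R n)).
Hypotheses (n_gt0 : (0 < n)%N) (Omega_open : open Omega).
Hypotheses (Phi_smooth : smooth_on Omega Phi).
Hypotheses (Phi_hormander : hormander_on Omega Phi).
Variables (r eps : R).
Hypotheses (eps_lt_r : eps < r).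
Hypothesis r_Omega : forall p : param R n, `|p| < r -> Omega p.
Hypothesis r_inj : forall u u' : 'rV[R]_m,
  `|chart_param u| < r -> `|chart_param u'| < r ->
  0 < chart_speed u -> 0 < chart_speed u' ->
  spray_map Phi u = spray_map Phi u' -> u = u'.

(** The speed is unbounded so that the image is conic; the strict bound on t makes the box open and
    decides where maximal geodesics stop. *)
Definition kakeya_box : set 'rV[R]_m :=
  [set u | [/\ eball eps (chart_w u), `|chart_t u| < eps,
               eball eps (chart_xi u) & 0 < chart_speed u]].

Lemma kakeya_box_open : open kakeya_box.
Proof.
have -> : kakeya_box = (chart_w @^-1` eball eps `&`
    (chart_t @^-1` ball (0 : R) eps `&`
    (chart_xi @^-1` eball eps `&` chart_speed @^-1` [set x | 0 < x]))).
  apply/seteqP; split=> u /=; rewrite -ball_normE /ball_/= sub0r normrN.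
    by case.
  by move=> [? [? []]].
do 3?apply: openI.
- apply: (@open_comp _ _ chart_w (eball eps)); last exact: eball_open.
  by move=> u _; exact: chart_w_continuous.
- apply: (@open_comp _ _ chart_t (ball (0 : R) eps)); last exact: ball_open.
  by move=> u _; exact: chart_t_continuous.
- apply: (@open_comp _ _ chart_xi (eball eps)); last exact: eball_open.
  by move=> u _; exact: chart_xi_continuous.
- apply: (@open_comp _ _ chart_speed [set x | 0 < x]); last exact: open_gt.
  by move=> u _; exact: chart_speed_continuous.
Qed.

(** The bound on t is not strict, so that the end points of the curves are covered in
    [curve_closure]. *)
Lemma norm_param_lt (w xi : 'rV[R]_n.-1) (t : R) :
  eball eps w -> `|t| <= eps -> eball eps xi -> `|((w, t, xi) : param R n)| < r.
Proof.
rewrite /eball/= => we te xie.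
rewrite !prod_normE/= !gt_max (le_lt_trans te eps_lt_r).
by rewrite !(le_lt_trans (norm_le_enorm _))// ?(lt_trans we)// (lt_trans xie).
Qed.

Lemma kakeya_box_norm u : kakeya_box u -> `|chart_param u| < r.
Proof. by move=> [we te xie _]; apply: norm_param_lt => //; exact: ltW. Qed.

Lemma kakeya_box_dom : kakeya_box `<=` spray_dom Omega.
Proof.
move=> u Ku; have [_ _ _ lu] := Ku.
by split=> //; apply: r_Omega; exact: kakeya_box_norm.
Qed.

(** The inverse of [spray_map] on the box, by choice; outside [kakeya_U] it takes the default value
    0. *)
Definition spray_chart (v : 'rV[R]_n * 'rV[R]_n) : 'rV[R]_m :=
  xget 0 [set u | kakeya_box u /\ spray_map Phi u = row_of_pair v].

Definition kakeya_U : set ('rV[R]_n * 'rV[R]_n) :=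
  [set v | exists2 u, kakeya_box u & spray_map Phi u = row_of_pair v].

Lemma spray_chartP v : kakeya_U v ->
  kakeya_box (spray_chart v) /\ spray_map Phi (spray_chart v) = row_of_pair v.
Proof.
move=> [u Ku uv]; rewrite /spray_chart.
by case: xgetP => [_ -> //|/(_ u)[]].
Qed.

Lemma spray_map_injK u u' : kakeya_box u -> kakeya_box u' ->
  spray_map Phi u = spray_map Phi u' -> u = u'.
Proof.
move=> Ku Ku'; apply: r_inj; [exact: kakeya_box_norm|exact: kakeya_box_norm| |].
- by have [] := Ku.
- by have [] := Ku'.
Qed.

Lemma kakeya_U_map u : kakeya_box u -> kakeya_U (pair_of_row (spray_map Phi u)).
Proof. by exists u => //; rewrite pair_of_rowK. Qed.

Lemma spray_chartK u : kakeya_box u ->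
  spray_chart (pair_of_row (spray_map Phi u)) = u.
Proof.
move=> Ku; have [Ku' E] := spray_chartP (kakeya_U_map Ku).
exact: (spray_map_injK Ku' Ku (etrans E (pair_of_rowK _))).
Qed.

Let chart_row (y : 'rV[R]_(n + n)) := spray_chart (pair_of_row y).

Let chart_rowK u : kakeya_box u -> chart_row (spray_map Phi u) = u.
Proof. exact: spray_chartK. Qed.

Lemma kakeya_UE : kakeya_U = row_of_pair @^-1` (spray_map Phi @` kakeya_box).
Proof. by apply/seteqP; split=> v [u Ku uv]; exists u. Qed.

Lemma inverse_jacobian : exists B : 'rV[R]_m -> 'M[R]_(n + n, m),
  (forall i j, smooth_on (spray_dom Omega) (fun u => B u i j)) /\
  (forall u, spray_dom Omega u ->
     jacobian (spray_map Phi) u *m B u = 1%:M /\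
     B u *m jacobian (spray_map Phi) u = 1%:M).
Proof.
have Do := spray_dom_open Omega_open.
apply: smooth_on_invmx => //.
  move=> i j; apply: smooth_on_coord => //; apply: smooth_on_jacobian => //.
  exact: spray_map_smooth.
exact: jacobian_spray_map_nondegenerate.
Qed.

Lemma image_kakeya_box_open : open (spray_map Phi @` kakeya_box).
Proof.
have [B [_ jacB]] := inverse_jacobian.
exact: (image_open (spray_dom_open Omega_open)
  (spray_map_smooth Omega_open Phi_smooth) jacB kakeya_box_open kakeya_box_dom).
Qed.

Lemma kakeya_U_open : open kakeya_U.
Proof.
rewrite kakeya_UE; apply: open_comp image_kakeya_box_open => v _.
exact: row_of_pair_continuous.
Qed.

Lemma kakeya_U_sub x y : kakeya_U (x, y) -> setT x /\ y != 0.
Proof.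
move=> [u Ku]; rewrite /spray_map /row_of_pair => /eq_row_mx[_ /= <-].
have [Ou lu] := kakeya_box_dom Ku; split=> //.
by rewrite scaler_eq0 gt_eqF//=; exact: hormander_dt_neq0 Phi_hormander _ Ou.
Qed.

Lemma kakeya_box_speed u l : kakeya_box u -> 0 < l ->
  kakeya_box (chart_point (chart_param u) l).
Proof.
move=> [we te xie _] l0.
have := chart_paramE (chart_param u) l; rewrite {1 3}/chart_param => -[wE tE xiE].
by split; rewrite ?wE ?tE ?xiE ?chart_speedE.
Qed.

(** [spray_map] is linear in the speed, so scaling a tangent multiplies the speed and leaves the
    parameters alone. Both conicity of [U] and homogeneity of [G] come from this. *)
Lemma kakeya_U_scale x y l : kakeya_U (x, y) -> 0 < l ->
  kakeya_U (x, l *: y) /\ spray_chart (x, l *: y) =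
    chart_point (chart_param (spray_chart (x, y))) (l * chart_speed (spray_chart (x, y))).
Proof.
move=> Uxy l0; have [] := spray_chartP Uxy; set u := spray_chart _ => Ku uE.
have [_ _ _ lu] := Ku; pose u' := chart_point (chart_param u) (l * chart_speed u).
have Ku' : kakeya_box u' by apply: kakeya_box_speed => //; exact: mulr_gt0.
have u'E : spray_map Phi u' = row_of_pair (x, l *: y).
  apply: (etrans (spray_map_point _ _ _)).
  move: uE; rewrite /spray_map /row_of_pair => /eq_row_mx[/= <- <-].
  by rewrite scalerA.
split; first by exists u'.
by rewrite -[RHS]/u' -(spray_chartK Ku') u'E row_of_pairK.
Qed.

Lemma kakeya_U_conic x (l : R) : 0 < l ->
  [set l *: y | y in [set y | kakeya_U (x, y)]] = [set y | kakeya_U (x, y)].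
Proof.
move=> l0; apply/seteqP; split=> [_ /= [y Uy <-]|y /= Uy].
  exact: (kakeya_U_scale Uy l0).1.
exists (l^-1 *: y); last by rewrite scalerA divff ?gt_eqF// scale1r.
by apply: (kakeya_U_scale Uy _).1; rewrite invr_gt0.
Qed.

(** The motion s -> Phi (w, t + l s, xi) has acceleration l^2 [dt (dt Phi)], which the geodesic
    equation requires to be -2 G. *)
Definition kakeya_G (v : 'rV[R]_n * 'rV[R]_n) : 'rV[R]_n :=
  - 2^-1 *: (chart_speed (spray_chart v) ^+ 2 *:
             dt (dt Phi) (chart_param (spray_chart v))).

Lemma kakeya_G_homogeneous x y (l : R) : kakeya_U (x, y) -> 0 < l ->
  kakeya_G (x, l *: y) = l ^+ 2 *: kakeya_G (x, y).
Proof.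
move=> Uxy l0; rewrite /kakeya_G (kakeya_U_scale Uxy l0).2.
rewrite (chart_speedE (chart_param _)) (chart_paramE (chart_param _)).
by rewrite !scalerA; congr (_ *: _); rewrite exprMn; ring.
Qed.

Lemma kakeya_G_smooth : smooth_on kakeya_U kakeya_G.
Proof.
have [B [sB jacB]] := inverse_jacobian.
have Do := spray_dom_open Omega_open.
apply: smooth_on_matrix => [|i j]; first exact: kakeya_U_open.
pose a u := - 2^-1 * (chart_speed u * chart_speed u *
  dt (dt Phi) (chart_param u) i j).
have sa : smooth_on (spray_dom Omega) a.
  apply: smooth_on_mul => //; first exact: smooth_on_cst.
  apply: smooth_on_mul => //.
    by apply: smooth_on_mul => //; exact: chart_speed_smooth.
  apply: smooth_on_coord => //; apply: (@smooth_on_chart_param _ _ _ Omega_open _ (dt (dt Phi))).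
  by do 2 apply: smooth_on_derive.
have sa' := inverse_smooth Do (spray_map_smooth Omega_open Phi_smooth) jacB
  kakeya_box_open kakeya_box_dom chart_rowK
  (fun i j => smooth_on_sub kakeya_box_dom (sB i j))
  (smooth_on_sub kakeya_box_dom sa).
have := smooth_on_linl image_kakeya_box_open (@row_of_pair_continuous R n) sa'.
rewrite -kakeya_UE; apply: smooth_on_eq; first exact: kakeya_U_open.
move=> v _ /=; rewrite /chart_row row_of_pairK /a /kakeya_G.
by rewrite expr2 !mxE.
Qed.

Definition kakeya_spray : spray_space R n :=
  SpraySpace (@openT _) kakeya_U_open kakeya_U_sub kakeya_U_conic
    kakeya_G_smooth kakeya_G_homogeneous.

End Spray.

(** * Geodesics *)

Section ConstantDerivative.
Context {R : realType}.

Lemma constant_derivative_le (J : set R) (f : R -> R) c : is_interval J ->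
  (forall s, J s -> is_derive s (1 : R) f c) ->
  forall a b, J a -> J b -> a <= b -> f b - f a = c * (b - a).
Proof.
move=> Ji df a b Ja Jb ab.
have inJ s : a <= s -> s <= b -> J s by move=> as_ sb; apply: (Ji a b) => //; apply/andP.
have df' (s : R) : s \in `]a, b[%R -> is_derive s (1 : R) f c.
  by rewrite in_itv/= => /andP[as_ sb]; apply: df; apply: inJ; exact: ltW.
have cf : {within `[a, b], continuous f}.
  apply: derivable_within_continuous => s; rewrite in_itv/= => /andP[as_ sb].
  by have [] := df s (inJ s as_ sb).
by have [s _ ->] := @MVT_segment R f (fun=> c) a b ab df' cf.
Qed.

Lemma constant_derivative (J : set R) (f : R -> R) c : is_interval J ->
  (forall s, J s -> is_derive s (1 : R) f c) ->
  forall a b, J a -> J b -> f b = f a + (b - a) * c.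
Proof.
move=> Ji df a b Ja Jb.
have [/(constant_derivative_le Ji df Ja Jb)|/ltW/(constant_derivative_le Ji df Jb Ja)] := leP a b; lra.
Qed.

Lemma constant_derivative_rV k (J : set R) (z : R -> 'rV[R]_k) v : is_interval J ->
  (forall s, J s -> is_derive s (1 : R) z v) ->
  forall a b, J a -> J b -> z b = z a + (b - a) *: v.
Proof.
move=> Ji dz a b Ja Jb; apply/rowP => j; rewrite !mxE.
apply: (constant_derivative (f := fun s => z s 0 j) Ji) => // s Js.
by apply: is_derive_coord; exact: dz.
Qed.

End ConstantDerivative.

Section Geodesics.
Context {R : realType} {n : nat}.
Local Notation m := (1 + (n.-1 + 1 + n.-1))%N.
Variables (Phi : param R n -> 'rV[R]_n) (Omega : set (param R n)).
Hypotheses (n_gt0 : (0 < n)%N) (Omega_open : open Omega).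
Hypotheses (Phi_smooth : smooth_on Omega Phi).
Hypotheses (Phi_hormander : hormander_on Omega Phi).
Variables (r eps : R).
Hypotheses (eps_gt0 : 0 < eps) (eps_lt_r : eps < r).
Hypothesis r_Omega : forall p : param R n, `|p| < r -> Omega p.
Hypothesis r_inj : forall u u' : 'rV[R]_m,
  `|chart_param u| < r -> `|chart_param u'| < r ->
  0 < chart_speed u -> 0 < chart_speed u' ->
  spray_map Phi u = spray_map Phi u' -> u = u'.

Let S : spray_space R n := kakeya_spray n_gt0 Omega_open Phi_smooth
  Phi_hormander eps_lt_r r_Omega r_inj.
Local Notation box := (@kakeya_box R n eps).
Local Notation chart := (spray_chart Phi eps).

(** The field l d/dt as a vector of the chart; the final 0 is its speed component. *)
Definition chart_dir (l : R) : 'rV[R]_m := chart_point (0, l, 0) 0.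

Lemma chart_move u k : k *: chart_dir (chart_speed u) + u =
  chart_point (chart_w u, chart_t u + k * chart_speed u, chart_xi u) (chart_speed u).
Proof.
rewrite -[in LHS](chart_pointK u) /chart_point /chart_dir /chart_point/=.
rewrite (chart_speedE (chart_param u)) !scale_row_mx !add_row_mx !scaler0 !add0r.
by rewrite !scale_scalar_mx mulr0 raddf0 add0r [in RHS]raddfD/= addrC.
Qed.

Lemma chart_dir_map u : spray_dom Omega u ->
  chart_dir (chart_speed u) *m jacobian (spray_map Phi) u =
  row_mx (chart_speed u *: dt Phi (chart_param u))
    (chart_speed u ^+ 2 *: dt (dt Phi) (chart_param u)).
Proof.
move=> Du; have [Ou _] := Du.
have dF := smooth_on_differentiable (spray_map_smooth Omega_open Phi_smooth) Du.
rewrite -deriveEjacobian// (derive_spray_map Omega_open Phi_smooth)//.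
rewrite (chart_paramE (0, chart_speed u, 0)) (chart_speedE (0, chart_speed u, 0)).
rewrite scale0r add0r.
have E (G : param R n -> 'rV[R]_n) : differentiable G (chart_param u) ->
    'D_((0, chart_speed u, 0) : param R n) G (chart_param u) =
    chart_speed u *: dt G (chart_param u).
  move=> dG; rewrite /dt !deriveE// -linearZ/=; congr ('d G (chart_param u) _).
  by congr (_, _, _); rewrite /= ?scaler0// /GRing.scale/= mulr1.
rewrite !E ?scalerA ?expr2//.
- exact: smooth_on_differentiable (smooth_on_derive _ Phi_smooth) Ou.
- exact: smooth_on_differentiable Phi_smooth Ou.
Qed.

Lemma spray_field_chart v : spray_U S v ->
  row_of_pair (spray_field S v) =
  chart_dir (chart_speed (chart v)) *m jacobian (spray_map Phi) (chart v).
Proof.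
move=> Uv; have [Ku uE] := spray_chartP Uv.
have Du := kakeya_box_dom eps_lt_r r_Omega Ku.
rewrite chart_dir_map// /row_of_pair /spray_field/=.
move: uE; rewrite /spray_map /row_of_pair => /eq_row_mx[_ <-].
congr row_mx; rewrite /kakeya_G scalerA mulrN divff ?pnatr_eq0//.
by rewrite scaleN1r opprK.
Qed.

(** Chain rule: the differential of the chart is multiplication by the inverse Jacobian, which
    cancels the Jacobian in [spray_field_chart]. *)
Lemma integral_curve_chart J h s : integral_curve S J h -> J s ->
  is_derive s (1 : R) (chart \o h) (chart_dir (chart_speed (chart (h s)))).
Proof.
move=> [Jo Ji _ Jh] Js; have [Us [dh hE]] := Jh s Js.
have [Ku uE] := spray_chartP Us.
have [B [sB jacB]] := inverse_jacobian n_gt0 Omega_open Phi_smooth Phi_hormander.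
have bD := kakeya_box_dom eps_lt_r r_Omega.
have gK u : box u -> (chart \o pair_of_row) (spray_map Phi u) = u.
  by move=> Kx; exact: (spray_chartK eps_lt_r r_inj Kx).
have [dg dgE] := inverse_differentiable (spray_dom_open Omega_open)
  (spray_map_smooth Omega_open Phi_smooth) jacB (kakeya_box_open (eps := eps)) bD gK Ku.
have dh1 : differentiable h s by exact/derivable1_diffP.
have [drh Drh] := differentiable_linr (@row_of_pair_continuous R n) dh1.
have -> : chart \o h = (chart \o pair_of_row) \o (row_of_pair \o h).
  by apply/funext => x /=; rewrite row_of_pairK.
rewrite uE in dg dgE.
have dc : differentiable ((chart \o pair_of_row) \o (row_of_pair \o h)) s.
  exact: differentiable_comp.
apply: DeriveDef; first exact: diff_derivable.
rewrite deriveE// diff_comp// dgE /= -deriveE// Drh hE/= spray_field_chart//.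
by rewrite -mulmxA (jacB _ (bD _ Ku)).1 mulmx1.
Qed.

(** The velocity in the chart depends on the current speed only. The speed component of that
    velocity is 0, so the speed is constant, hence so is the velocity. *)
Lemma integral_curve_line J h s0 : integral_curve S J h -> J s0 ->
  forall s, J s ->
  chart (h s) = (s - s0) *: chart_dir (chart_speed (chart (h s0))) + chart (h s0).
Proof.
move=> Jh Js0; have [_ Ji _ _] := Jh.
have spE u : chart_speed u = u 0 (lshift _ 0) by rewrite /chart_speed mxE.
have speed_cst s : J s -> chart_speed (chart (h s)) = chart_speed (chart (h s0)).
  move=> Js.
  have := constant_derivative (f := fun s => chart_speed (chart (h s))) (c := 0) Ji _ Js0 Js.
  rewrite mulr0 addr0; apply=> s' Js'.
  have := is_derive_coord 0 (lshift _ 0) (integral_curve_chart Jh Js').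
  rewrite -spE (chart_speedE (0, _, 0)).
  by congr (is_derive _ _ _ _); apply/funext => x /=; rewrite spE.
move=> s Js; rewrite addrC.
apply: (constant_derivative_rV (z := chart \o h) Ji) => // s' Js'.
by rewrite -(speed_cst s' Js'); exact: (integral_curve_chart Jh Js').
Qed.

Definition geodesic_dom (u : 'rV[R]_m) (s0 : R) : set R :=
  [set s | `|chart_t u + (s - s0) * chart_speed u| < eps].

Definition geodesic_lift (u : 'rV[R]_m) (s0 s : R) : 'rV[R]_n * 'rV[R]_n :=
  pair_of_row (spray_map Phi ((s - s0) *: chart_dir (chart_speed u) + u)).

Lemma kakeya_box_line u s0 s : box u ->
  box ((s - s0) *: chart_dir (chart_speed u) + u) <-> geodesic_dom u s0 s.
Proof.
move=> [we te xie lu]; rewrite chart_move /kakeya_box/=.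
have := chart_paramE ((chart_w u, chart_t u + (s - s0) * chart_speed u, chart_xi u) : param R n) (chart_speed u).
rewrite {1}/chart_param => -[wE tE xiE]; rewrite wE tE xiE (chart_speedE (_, _, _)).
by split=> [[]|].
Qed.

(** Any integral curve is a restriction of the explicit one through the same point: its chart is a
    line, and it stays in the box because the curve stays in [U]. This takes the place of uniqueness
    for the differential equation. *)
Lemma integral_curve_sub J h s0 : integral_curve S J h -> J s0 ->
  J `<=` geodesic_dom (chart (h s0)) s0 /\
  forall s, J s -> h s = geodesic_lift (chart (h s0)) s0 s.
Proof.
move=> Jh Js0; have [_ _ _ JU] := Jh.
have [Ku _] := spray_chartP (JU s0 Js0).1.
split=> s Js; have [Ks hsE] := spray_chartP (JU s Js).1.
  by apply/(kakeya_box_line _ _ Ku); rewrite -(integral_curve_line Jh Js0 Js).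
by rewrite /geodesic_lift -(integral_curve_line Jh Js0 Js) hsE row_of_pairK.
Qed.

Lemma geodesic_lift_integral_curve u s0 : box u ->
  integral_curve S (geodesic_dom u s0) (geodesic_lift u s0).
Proof.
move=> Ku; have [we te xie lu] := Ku; split.
- pose a s := chart_t u + (s - s0) * chart_speed u.
  have -> : geodesic_dom u s0 = a @^-1` ball 0 eps.
    by apply/seteqP; split=> s; rewrite /= -ball_normE /ball_/= sub0r normrN.
  apply: open_comp; last exact: ball_open.
  move=> s _; apply: cvgD; first exact: cvg_cst.
  by apply: cvgMl; apply: cvgB; [exact: cvg_id|exact: cvg_cst].
- move=> a b; rewrite /geodesic_dom/= => aI bI s /andP[as_ sb].
  have h1 : (a - s0) * chart_speed u <= (s - s0) * chart_speed u.
    by apply: ler_wpM2r; [exact: ltW|lra].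
  have h2 : (s - s0) * chart_speed u <= (b - s0) * chart_speed u.
    by apply: ler_wpM2r; [exact: ltW|lra].
  move: aI bI; rewrite !ltr_norml => /andP[? ?] /andP[? ?].
  by apply/andP; split; lra.
- by exists s0; rewrite /geodesic_dom/= subrr mul0r addr0.
move=> s sI; have Ks := (kakeya_box_line s0 s Ku).2 sI.
have Us := kakeya_U_map Phi Ks.
split; first exact: Us.
(* Puts the line in the form s *: v + y expected by [is_derive_line]. *)
have [y lE] : exists y, forall s', (s' - s0) *: chart_dir (chart_speed u) + u =
    s' *: chart_dir (chart_speed u) + y.
  exists (u - s0 *: chart_dir (chart_speed u)) => s'.
  by rewrite scalerBl addrA addrAC.
have speed_w : chart_speed ((s - s0) *: chart_dir (chart_speed u) + u) = chart_speed u.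
  by rewrite chart_move (chart_speedE (_, _, _)).
have Ds := kakeya_box_dom eps_lt_r r_Omega Ks.
have dF := smooth_on_differentiable (spray_map_smooth Omega_open Phi_smooth) Ds.
have Dline := is_derive_line (f := spray_map Phi) (y := y)
  (v := chart_dir (chart_speed u)) (s := s).
have liftE : geodesic_lift u s0 = pair_of_row \o
    (fun s' : R => spray_map Phi (s' *: chart_dir (chart_speed u) + y)).
  by apply/funext => s' /=; rewrite /geodesic_lift lE.
have liftsE : geodesic_lift u s0 s =
  pair_of_row (spray_map Phi ((s - s0) *: chart_dir (chart_speed u) + u)) by [].
rewrite liftsE; move: liftE => ->.
move: Ks Us speed_w dF Dline; rewrite -(lE s).
move: ((s - s0) *: chart_dir (chart_speed u) + u) => w Ks Us speed_w dF /(_ dF).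
move: (fun s' : R => _) => line [dl Dl].
have dl1 : differentiable line s by exact/derivable1_diffP.
have [dc Dc] := differentiable_linr (@pair_of_row_continuous R n) dl1.
apply: DeriveDef; first exact: diff_derivable.
apply: (etrans (Dc 1)); apply: (can_inj row_of_pairK).
apply: (etrans (pair_of_rowK _)); rewrite Dl (deriveEjacobian _ dF).
by rewrite (spray_field_chart Us) (spray_chartK eps_lt_r r_inj Ks) speed_w.
Qed.

Lemma geodesic_lift0 u s0 : geodesic_lift u s0 s0 = pair_of_row (spray_map Phi u).
Proof. by rewrite /geodesic_lift subrr scale0r add0r. Qed.

Lemma geodesic_lift_image u s0 : box u ->
  [set (geodesic_lift u s0 s).1 | s in geodesic_dom u s0] =
  curve_interior Phi eps (chart_w u) (chart_xi u).
Proof.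
move=> [we te xie lu].
have E s : (geodesic_lift u s0 s).1 =
    Phi (chart_w u, chart_t u + (s - s0) * chart_speed u, chart_xi u).
  by rewrite /geodesic_lift chart_move (spray_map_point _ (_, _, _)) /= row_mxKl.
apply/seteqP; split=> [_ [s sI <-]|_ [t tI <-]].
  by rewrite E; exists (chart_t u + (s - s0) * chart_speed u) => //=; rewrite in_itv/= -ltr_norml.
(* The time at which the affine t-coordinate reaches the prescribed t. *)
exists (s0 + (t - chart_t u) / chart_speed u).
  rewrite /geodesic_dom/= [s0 + _]addrC addrK divfK ?gt_eqF// addrC subrK.
  by move: tI; rewrite /= in_itv/= -ltr_norml.
by rewrite E [s0 + _]addrC addrK divfK ?gt_eqF// [_ + (t - _)]addrC subrK.
Qed.

Lemma geodesic_lift_maximal u s0 : box u ->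
  maximal_integral_curve S (geodesic_dom u s0) (geodesic_lift u s0).
Proof.
move=> Ku; split; first exact: geodesic_lift_integral_curve.
move=> J h Jh IJ hE.
have Is0 : geodesic_dom u s0 s0.
  by have [_ te _ _] := Ku; rewrite /geodesic_dom/= subrr mul0r addr0.
have [JI _] := integral_curve_sub Jh (IJ _ Is0).
move: JI; rewrite hE// geodesic_lift0 (spray_chartK eps_lt_r r_inj Ku).
exact.
Qed.

Lemma kakeya_geodesic u : box u ->
  geodesic_with_tangent S (pair_of_row (spray_map Phi u))
    (curve_interior Phi eps (chart_w u) (chart_xi u)).
Proof.
move=> Ku; exists (geodesic_dom u 0), (geodesic_lift u 0); split.
- exact: geodesic_lift_maximal.
- exists 0; last exact: geodesic_lift0.
  by have [_ te _ _] := Ku; rewrite /geodesic_dom/= subrr mul0r addr0.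
- by rewrite geodesic_lift_image.
Qed.

(** The given maximal curve is a restriction of the explicit one, and its own maximality forbids a
    proper extension, so the two domains coincide. *)
Lemma kakeya_geodesicE v C : geodesic_with_tangent S v C ->
  C = curve_interior Phi eps (chart_w (chart v)) (chart_xi (chart v)).
Proof.
move=> [I [g [[Ig gmax] [s0 Is0 <-] ->]]].
have [_ _ _ IU] := Ig; have [Ku uE] := spray_chartP (IU s0 Is0).1.
have [Isub gE] := integral_curve_sub Ig Is0.
have subI := gmax _ _ (geodesic_lift_integral_curve s0 Ku) Isub
  (fun s Is => esym (gE s Is)).
rewrite -(geodesic_lift_image s0 Ku).
have -> : I = geodesic_dom (chart (g s0)) s0 by exact/seteqP.
apply/seteqP; split=> _ [s sI <-]; exists s => //.
  by rewrite -gE//; exact: subI.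
by rewrite gE//; exact: subI.
Qed.

(** The full curve is a compact image of [-eps, eps], hence closed; conversely, by continuity up to
    the end points, each of its points is a limit of interior ones. *)
Lemma curve_closure w xi : eball eps w -> eball eps xi ->
  closure (curve_interior Phi eps w xi) = curve Phi eps w xi.
Proof.
move=> we xie; pose f t := Phi (w, t, xi).
have cf t : `|t| <= eps -> {for t, continuous f}.
  move=> te; have Op := r_Omega (norm_param_lt eps_lt_r we te xie).
  have dP := differentiable_continuous (smooth_on_differentiable Phi_smooth Op).
  apply: (@continuous_comp _ _ _ (fun t => (w, t, xi) : param R n) Phi) => //.
  exact: (cvg_pair (cvg_pair (@cvg_cst _ w _ _ _) (@cvg_id _ _)) (@cvg_cst _ xi _ _ _)).
apply/seteqP; split.
  have : closed (curve Phi eps w xi).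
    apply: compact_closed; first exact: norm_hausdorff.
    apply: (@continuous_compact _ _ f); last exact: segment_compact.
    apply: continuous_in_subspaceT => t; rewrite inE/= in_itv/= => te.
    by apply: cf; rewrite ler_norml.
  move=> ccl; rewrite closureE; apply: smallest_sub => //.
  move=> _ [t te <-]; exists t => //; move: te; rewrite /= !in_itv/=.
  by move=> /andP[? ?]; rewrite !ltW.
move=> _ [t te <-] V Vt.
have te' : `|t| <= eps by rewrite ler_norml; move: te; rewrite /= in_itv.
have : nbhs t (f @^-1` V) by exact: cf.
have tcl : closure `]- eps, eps[ t.
  move=> A /nbhs_ballP[d d0 dA].
  (* The point (1 - c) t lies in the open interval, and its distance c |t| to t is at most c eps <=
     d / 2. *)
  pose c := Num.min 2^-1 (d / (2 * eps)).
  have c0 : 0 < c by rewrite lt_min invr_gt0 ltr0Sn divr_gt0// mulr_gt0.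
  have c1 : c < 1 by rewrite gt_min invf_lt1// ltr1n.
  have cd : c * (2 * eps) <= d by rewrite -ler_pdivlMr ?mulr_gt0// ge_min lexx orbT.
  have ct : c * `|t| <= c * eps by rewrite ler_pM2l.
  have d0' : 0 < d by [].
  exists ((1 - c) * t); split.
    rewrite /= in_itv/= -ltr_norml normrM gtr0_norm ?subr_gt0//.
    have ce : 0 < c * eps by rewrite mulr_gt0.
    have : (1 - c) * `|t| <= (1 - c) * eps by rewrite ler_pM2l ?subr_gt0.
    lra.
  apply: dA; rewrite -ball_normE /ball_/= mulrBl mul1r opprB addrC subrK.
  have ce : 0 < c * eps by rewrite mulr_gt0.
  by rewrite normrM gtr0_norm//; lra.
move=> /tcl[t' [t'e Vt']]; exists (f t'); split=> //.
by exists t'.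
Qed.

End Geodesics.

Unset Implicit Arguments.

Theorem proposition1p26 (R : realType) (n : nat) (n_ge2 : (2 <= n)%N)
    (Phi : param R n -> 'rV[R]_n) (Omega : set (param R n))
    (Omega_open : open Omega) (Omega_origin : Omega 0)
    (Phi_smooth : smooth_on Omega Phi)
    (Phi_hormander : hormander_on Omega Phi) :
  exists2 eps0 : R, 0 < eps0 &
  forall eps : R, 0 < eps -> eps <= eps0 ->
  exists (S : spray_space R n)
         (W Xi : 'rV[R]_n * 'rV[R]_n -> 'rV[R]_n.-1),
  [/\ forall v, spray_U S v -> eball eps (W v) /\ eball eps (Xi v),
      forall v, spray_U S v ->
        (exists C, geodesic_with_tangent S v C) /\
        (forall C, geodesic_with_tangent S v C ->
           is_curve Phi eps (W v) (Xi v) C) &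
      forall w xi : 'rV[R]_n.-1, eball eps w -> eball eps xi ->
        exists2 C, is_geodesic S C & is_curve Phi eps w xi C].
Proof.
have n_gt0 : (0 < n)%N by exact: leq_trans n_ge2.
have [r r0 [r_Omega r_inj]] := spray_map_injective n_gt0 Omega_open Omega_origin
  Phi_smooth Phi_hormander.
(* Half of r, so that eps <= eps0 gives the strict inequality eps < r. *)
exists (r / 2) => [|eps eps0 eps_le]; first by rewrite divr_gt0.
have eps_lt_r : eps < r by apply: le_lt_trans eps_le _; rewrite gtr_pMr// invf_lt1// ltr1n.
exists (kakeya_spray n_gt0 Omega_open Phi_smooth Phi_hormander eps_lt_r r_Omega r_inj).
exists (fun v => chart_w (spray_chart Phi eps v)), (fun v => chart_xi (spray_chart Phi eps v)).
have curveP w xi : eball eps w -> eball eps xi ->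
    is_curve Phi eps w xi (curve_interior Phi eps w xi).
  by move=> we xie; split=> //; exact: (curve_closure Phi_smooth eps0 eps_lt_r r_Omega).
split=> [v Uv|v Uv|w xi we xie].
- by have [[]] := spray_chartP Uv.
- have [Ku uE] := spray_chartP Uv; split.
    exists (curve_interior Phi eps (chart_w (spray_chart Phi eps v)) (chart_xi (spray_chart Phi eps v))).
    have := kakeya_geodesic n_gt0 Omega_open Phi_smooth Phi_hormander eps_lt_r r_Omega r_inj Ku.
    by rewrite uE row_of_pairK.
  move=> C /kakeya_geodesicE ->; have [we _ xie _] := Ku.
  exact: curveP.
(* To realize a given curve as a geodesic, its tangent at t = 0 with speed 1 is taken as initial
   vector. *)
have Ku : kakeya_box eps (chart_point ((w, 0, xi) : param R n) 1).
  have := chart_paramE ((w, 0, xi) : param R n) 1; rewrite {1}/chart_param => -[wE tE xiE].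
  by split; rewrite ?wE ?tE ?xiE ?(chart_speedE (_, _, _)) ?normr0.
have := kakeya_geodesic n_gt0 Omega_open Phi_smooth Phi_hormander eps_lt_r r_Omega r_inj Ku.
have := chart_paramE ((w, 0, xi) : param R n) 1; rewrite {1}/chart_param => -[-> _ ->] gC.
exists (curve_interior Phi eps w xi); last exact: curveP.
eexists; last exact: gC.
exact: kakeya_U_map.
Qed.
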